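(* Let $q\in L_{1,1}$ and let $f(k)$ be the corresponding Jost function. If $f(0)=0$, then the derivative $\dot f(0)$ exists and $\dot f(0)\neq0$.
   Context: $\mathbb{R}_+=[0,\infty)$. $L_{1,1}$ is the set of real-valued functions $q$ on $\mathbb{R}_+$ with $\int_0^\infty(1+x)|q(x)|\,dx<\infty$ and $q\in L^2(0,a)$ for every $a<\infty$. For $q\in L_{1,1}$ and $\operatorname{Im}k\ge0$, the Jost solution $f(x,k)$ is the unique solution of $-f''+q(x)f=k^2f$, $x>0$, with $f(x,k)=e^{ikx}+o(1)$ as $x\to+\infty$. The Jost function $f(k):=f(0,k)$ is defined for $\operatorname{Im}k\ge0$. The dot denotes $d/dk$, so when $f(0)=0$ one has $\dot f(0)=\lim_{k\to0}f(k)/k$, where $k\to 0$ within the domain $\operatorname{Im}k\ge0$, $k\ne0$.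
   Formalization: For Im k>0 the asymptotics f(x,k)=e^{ikx}+o(1) does not determine the Jost solution (every multiple of it satisfies this), so it is read as f(x,k)=e^{ikx}(1+o(1)), which agrees with the original for real k. *)

(* Defs.v *)
From HB Require Import structures.
From mathcomp Require Import all_boot all_order all_algebra.
From mathcomp Require Import all_classical all_reals all_analysis.
From mathcomp Require Import complex.

Set Implicit Arguments.
Unset Strict Implicit.
Unset Printing Implicit Defensive.

Import Order.TTheory GRing.Theory Num.Theory.
Import numFieldNormedType.Exports.

Local Open Scope classical_set_scope.
Local Open Scope ring_scope.
Local Open Scope complex_scope.

(* Complex numbers are R[i]; the alias R[i]^o carries the same elements with the
   topology given by the modulus.  A function on [0, +oo[ is a total function on
   R of which only the values at x >= 0 are ever constrained or used. *)

Definition L11 (R : realType) (q : R -> R) : Prop :=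
  [/\ measurable_fun (`[0, +oo[ : set R) q,
      (\int[@lebesgue_measure R]_(x in `[0%R, +oo[)
         ((1 + x) * `|q x|)%:E < +oo)%E &
      forall a : R,
        (\int[@lebesgue_measure R]_(x in `]0%R, a[) ((q x) ^+ 2)%:E < +oo)%E].

Definition cexp (R : realType) (z : R[i]) : R[i] :=
  (expR (complex.Re z))%:C * (cos (complex.Im z) +i* sin (complex.Im z)).

Definition is_cderive (R : realType) (y : R -> R[i]) (x : R) (d : R[i]) : Prop :=
  is_derive x 1 (fun t => complex.Re (y t)) (complex.Re d) /\
  is_derive x 1 (fun t => complex.Im (y t)) (complex.Im d).

Definition abs_continuous (R : realType) (a b : R) (g : R -> R) : Prop :=
  forall e : R, 0 < e -> exists2 d : R, 0 < d &
    forall (n : nat) (u v : 'I_n -> R),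
      (forall i, a <= u i /\ u i <= v i /\ v i <= b) ->
      trivIset [set: 'I_n] (fun i => `]u i, v i[%classic) ->
      \sum_(i < n) (v i - u i) < d ->
      \sum_(i < n) `|g (v i) - g (u i)| < e.

Definition cabs_continuous (R : realType) (a b : R) (y : R -> R[i]) : Prop :=
  abs_continuous a b (fun t => complex.Re (y t)) /\
  abs_continuous a b (fun t => complex.Im (y t)).

(* Since q is only locally integrable, - y'' + q y = z y on ]0, +oo[ is meant in
   the Caratheodory sense: y and y' are absolutely continuous on every [0, b],
   and the equation holds almost everywhere. *)
Definition schrodinger_solution (R : realType) (q : R -> R) (z : R[i])
    (y : R -> R[i]) : Prop :=
  exists y' : R -> R[i],
    [/\ forall x : R, 0 < x -> is_cderive y x (y' x),
        forall b : R, 0 < b -> cabs_continuous 0 b y /\ cabs_continuous 0 b y' &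
        {ae @lebesgue_measure R, forall x : R, 0 < x ->
          exists2 y2 : R[i], is_cderive y' x y2 &
            - y2 + (q x)%:C * y x = z * y x}].

(* The asymptotics at +oo is y(x) = e^{ikx} (1 + o(1)).  For real k this is the
   same as y(x) = e^{ikx} + o(1).  For Im k > 0 the latter would only say that
   y(x) = o(1), which holds for every multiple of the Jost solution; the relative
   form is the one that determines y. *)
Definition jost_solution (R : realType) (q : R -> R) (k : R[i])
    (y : R -> R[i]) : Prop :=
  schrodinger_solution q (k ^+ 2) y /\
  ((y x / cexp ('i%C * k * x%:C) : R[i]^o) @[x --> +oo%R] --> (1 : R[i]^o)).

(* F is the Jost function of q: F k = f(0, k), f(., k) being the Jost solution.
   The values of F outside the closed upper half-plane are unconstrained. *)
Definition jost_function (R : realType) (q : R -> R) (F : R[i] -> R[i]) : Prop :=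
  forall k : R[i], 0 <= complex.Im k ->
    exists2 y : R -> R[i], jost_solution q k y & F k = y 0.

(* d is the derivative of F at k0 relative to the closed upper half-plane;
   the punctured filter k0^' imposes k != k0. *)
Definition is_derivative_uhp (R : realType) (F : R[i] -> R[i]) (k0 d : R[i]) :
    Prop :=
  ((F k - F k0) / (k - k0) : R[i]^o)
    @[k --> within [set k : R[i]^o | 0 <= complex.Im k] (k0 : R[i]^o)^']
    --> (d : R[i]^o).

(* Main.v *)
(** Let f be the Jost solution at k = 0, with f(0) = 0, and y the one at k.  The
   Wronskian W = y f' - y' f satisfies W' = k^2 y f and W(0) = F(k) f'(0), while
   W ~ -i k at infinity; hence F(k)/k --> -i / f'(0).  To make this uniform for
   Im k >= 0, W is evaluated at X = e / |k|: with y = m e^(ikx), the bounds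
   |m - 1| = O(\int_X^oo t |q|) and |m'| = O(\int_X^oo |q|) = o(1/X) = o(k) hold
   uniformly in k.  Finally f'(0) <> 0, since otherwise f = 0 by Gronwall.

   Every estimate on a solution integrates a differential inequality by means of
   a single fact: an absolutely continuous function with nonnegative derivative
   almost everywhere is nondecreasing. *)

Require Import Defs.
From HB Require Import structures.
From mathcomp Require Import all_boot all_order all_algebra.
From mathcomp Require Import all_classical all_reals all_analysis.
From mathcomp Require Import complex.
From mathcomp Require Import measurable_realfun ring lra zify.

Set Implicit Arguments.
Unset Strict Implicit.
Unset Printing Implicit Defensive.

Import Order.TTheory GRing.Theory Num.Theory.
Import numFieldNormedType.Exports.

Local Open Scope classical_set_scope.
Local Open Scope ring_scope.
Local Open Scope complex_scope.
Import Normc.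

(** * Monotonicity of absolutely continuous functions *)

(** For real [k] the product of the two solutions does not decay, so [k^2] times its integral over
    the whole half-line admits no absolute bound; this is why the Wronskian is stopped at a finite
    point. A Jost solution is given only by its equation and its limit at infinity, not as the fixed
    point of a Volterra equation, so the estimates on [m] are a priori ones: the decay of [m'],
    about which the limit says nothing, has to be deduced, and the supremum of [|m|] enters its own
    bound before being absorbed. These bounds hold past a point [A] independent of [k]; on [[0, A]]
    an energy estimate takes over. Integrals of solutions never appear: increments are compared with
    explicit primitives built from two tail functions of [q]. *)

Lemma ae_imply (R : realType) (P Q : R -> Prop) : (forall x, P x -> Q x) ->
  {ae @lebesgue_measure R, forall x, P x} -> {ae @lebesgue_measure R, forall x, Q x}.
Proof.
move=> PQ; apply: filterS; first exact: (ae_filter_ringOfSetsType lebesgue_measure).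
exact: PQ.
Qed.

Lemma ae_imply2 (R : realType) (P Q S : R -> Prop) : (forall x, P x -> Q x -> S x) ->
  {ae @lebesgue_measure R, forall x, P x} -> {ae @lebesgue_measure R, forall x, Q x} ->
  {ae @lebesgue_measure R, forall x, S x}.
Proof.
move=> PQS; apply: filterS2; first exact: (ae_filter_ringOfSetsType lebesgue_measure).
exact: PQS.
Qed.

(** The supremum [s] of the points reached is itself reached from a nearby point below it, and then
    passed unless it is [b]. Only moves that start or end at [s] are demanded, because a derivative
    at [s] compares nearby values of a function with its value at [s] alone. *)
Lemma closed_interval_induction (R : realType) (a b : R) (P : R -> Prop) :
  a <= b -> P a ->
  (forall s, a <= s <= b -> exists2 r : R, 0 < r &
    forall x y, a <= x -> y <= b -> s - r < x -> x <= y -> y < s + r ->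
      x <= s <= y -> (x = s \/ y = s) -> P x -> P y) ->
  P b.
Proof.
move=> ab Pa step.
pose S := [set x : R | a <= x <= b /\ P x].
have S0 : S a by split=> //; rewrite lexx.
have hS : has_sup S.
  by split; [exists a | exists b => x [/andP[]]].
set s := sup S.
have as_ : a <= s by apply: ub_le_sup => //; case: hS.
have sb : s <= b by apply: ge_sup => [|x [/andP[]]//]; exists a.
have [|r r0 hr] := step s; first by rewrite as_ sb.
have [x [/andP[ax xb] Px] xs] := sup_adherent r0 hS.
have xs' : x <= s by apply: ub_le_sup; [case: hS | split=> //; rewrite ax xb].
have Ps : P s.
  apply: (hr x s) => //; [by rewrite ltrDl| by rewrite xs' lexx | by right].
have [sltb|] := ltP s b; last by move=> bs; have -> : b = s by apply/le_anti/andP.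
pose y := Num.min b (s + r / 2).
have sy : s < y by rewrite lt_min sltb ltrDl divr_gt0.
have yb : y <= b by rewrite ge_min lexx.
have ysr : y <= s + r / 2 by rewrite ge_min lexx orbT.
have Py : P y.
  apply: (hr s y) => //; first by lra.
  - exact: ltW.
  - by lra.
  - by rewrite lexx ltW.
  - by left.
have : y <= s.
  apply: ub_le_sup; first by case: hS.
  by split=> //; rewrite yb andbT (le_trans as_) ?ltW.
by rewrite leNgt sy.
Qed.

(* The possible decrease of [g] is charged either to the slope [e], or to
   intervals that [U] contains. *)
Lemma decrease_on_open_cover (R : realType) (a b e : R) (g : R -> R) (U : set R) :
  a <= b -> 0 < e -> open U ->
  (forall x, a <= x <= b -> ~ U x -> exists2 d : R, is_derive x 1 g d & 0 <= d) ->
  exists n (u v : nat -> R),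
    [/\ forall i, (i < n)%N -> [/\ a <= u i, u i <= v i & v i <= b],
        forall i j, (i < j < n)%N -> v i <= u j,
        forall i, (i < n)%N -> `]u i, v i[%classic `<=` U &
        g a <= g b + e * (b - a) + \sum_(i < n) `|g (v i) - g (u i)|].
Proof.
move=> ab e0 oU hg.
pose P x := exists n (u v : nat -> R),
    [/\ forall i, (i < n)%N -> [/\ a <= u i, u i <= v i & v i <= x],
        forall i j, (i < j < n)%N -> v i <= u j,
        forall i, (i < n)%N -> `]u i, v i[%classic `<=` U &
        g a <= g x + e * (x - a) + \sum_(i < n) `|g (v i) - g (u i)|].
apply: (@closed_interval_induction R a b P) => //.
  exists 0%N, (fun=> 0), (fun=> 0); split=> [//|i j|//|].
    by rewrite ltn0 andbF.
  by rewrite big_ord0 subrr mulr0 !addr0.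
(* Near a point of [U] the whole interval []x, y[] is appended to the list; near any other point the
   list is kept and the slope [e] pays for the decrease. *)
have stepU x y : a <= x -> x <= y -> `]x, y[ `<=` U -> P x -> P y.
  move=> ax xy xyU [n [u [v [h1 h2 h3 h4]]]].
  exists n.+1, (fun i => if (i < n)%N then u i else x),
    (fun i => if (i < n)%N then v i else y); split.
  - move=> i _; case: (ltnP i n) => [ilt|_]; last by split.
    by have [? ? vx] := h1 i ilt; split=> //; exact: le_trans xy.
  - move=> i j /andP[ij jn]; have ilt : (i < n)%N by lia.
    rewrite ilt; case: (ltnP j n) => jlt; first by apply: h2; rewrite ij.
    by have [] := h1 i ilt.
  - by move=> i _; case: (ltnP i n) => [/h3//|].
  - rewrite big_ord_recr /= ltnn.
    under eq_bigr do rewrite ltn_ord.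
    have := ler_norm (g x - g y); rewrite distrC.
    have : e * (x - a) <= e * (y - a) by rewrite ler_pM2l //; lra.
    move: h4; set w := \sum_(_ < _) _; lra.
have stepD x y : x <= y -> g x - g y <= e * (y - x) -> P x -> P y.
  move=> xy xyD [n [u [v [h1 h2 h3 h4]]]].
  exists n, u, v; split=> //.
    by move=> i /h1[? ? vx]; split=> //; exact: le_trans xy.
  apply: (le_trans h4); rewrite lerD2r.
  have -> : e * (y - a) = e * (y - x) + e * (x - a) by ring.
  lra.
move=> s sab; have [Us|Us] := pselect (U s).
  have /nbhs_ballP[r r0 hr] : nbhs s U by exact: open_nbhs_nbhs.
  exists r => // x y ax yb sx xy ys _ _; apply: stepU => // z /=.
  rewrite in_itv/= => /andP[xz zy]; apply: hr; rewrite /ball/= ltr_norml; lra.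
have [d gd d0] := hg s sab Us.
have [dg gE] := gd.
have : h^-1 *: (g (h *: 1 + s) - g s) @[h --> 0^'] --> d.
  by rewrite -gE; apply: dg.
move=> /cvgrPdist_lt/(_ _ e0)[r /= r0 hr].
exists r => // x y ax yb sx xy ys _ hxy; apply: stepD => //.
have key h : h != 0 -> `|h| < r -> `|d - h^-1 * (g (h + s) - g s)| < e.
  move=> h0 hlt; have := hr h; rewrite /= sub0r normrN => /(_ hlt h0).
  by rewrite /GRing.scale /= mulr1.
case: hxy => [xs|ys'].
  subst x; have [->|sny] := eqVneq y s; first by rewrite !subrr mulr0.
  have ylt : s < y by rewrite lt_neqAle eq_sym sny.
  have := key (y - s); rewrite subrK subr_eq0 sny => /(_ isT).
  rewrite ltr_norml => /(_ ltac:(lra)) /ltr_normlW.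
  rewrite ltrBlDr -ltrBlDl => h.
  have {h} : (d - e) * (y - s) < g y - g s.
    by rewrite -ltr_pdivlMr ?subr_gt0 // mulrC.
  have : 0 <= d * (y - s) by rewrite mulr_ge0 // subr_ge0 ltW.
  rewrite mulrBl; lra.
subst y; have [->|snx] := eqVneq x s; first by rewrite !subrr mulr0.
have xlt : x < s by rewrite lt_neqAle snx.
have := key (x - s); rewrite subrK subr_eq0 snx => /(_ isT).
rewrite ltr_norml => /(_ ltac:(lra)) /ltr_normlW.
rewrite ltrBlDr -ltrBlDl => h.
have {h} : (d - e) * (s - x) < g s - g x.
  rewrite -ltr_pdivlMr ?subr_gt0 //; apply: (lt_le_trans h).
  by rewrite -(opprB s x) -(opprB (g s)) invrN mulrNN mulrC.
have : 0 <= d * (s - x) by rewrite mulr_ge0 // subr_ge0 ltW.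
rewrite mulrBl; lra.
Qed.

Lemma trivIset_ordered_itv (R : realType) n (u v : nat -> R) :
  (forall i j, (i < j < n)%N -> v i <= u j) ->
  trivIset [set: 'I_n] (fun i => `]u i, v i[%classic).
Proof.
move=> ord i j _ _ [x [/= ]]; rewrite !in_itv/= => /andP[ux xv] /andP[ux' xv'].
apply/val_inj/eqP; case: (ltngtP i j) => // ij.
- by have := ord i j; rewrite ij ltn_ord => /(_ isT); lra.
- by have := ord j i; rewrite ij ltn_ord => /(_ isT); lra.
Qed.

Lemma lebesgue_measure_oo (R : realType) (u v : R) : u <= v ->
  @lebesgue_measure R `]u, v[%classic = (v - u)%:E.
Proof.
move=> uv; rewrite lebesgue_measure_itv/= lte_fin lt_neqAle uv andbT.
by case: eqVneq => [->|//]; rewrite subrr.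
Qed.

Lemma sum_length_le_measure (R : realType) n (u v : nat -> R) (U : set R) :
  measurable U ->
  (forall i, (i < n)%N -> u i <= v i) ->
  (forall i j, (i < j < n)%N -> v i <= u j) ->
  (forall i, (i < n)%N -> `]u i, v i[%classic `<=` U) ->
  ((\sum_(i < n) (v i - u i))%:E <= @lebesgue_measure R U)%E.
Proof.
move=> mU uv ord sub.
have mI i : measurable (`]u i, v i[%classic : set R) by exact: measurable_itv.
rewrite -sumEFin.
under eq_bigr => i _.
  have -> : (v i - u i)%:E = @lebesgue_measure R `]u i, v i[%classic.
    by rewrite lebesgue_measure_oo // uv.
  over.
rewrite -(@measure_bigsetU_ord _ _ _ lebesgue_measure n predT
  (fun i => `]u i, v i[%classic)) //; last exact: trivIset_ordered_itv.
apply: le_measure; rewrite ?inE//; first by apply: bigsetU_measurable.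
by rewrite -(bigcup_mkord n (fun i => `]u i, v i[%classic)) => x [i /= /sub]; apply.
Qed.

(** The exceptional null set is covered by an open [U] of measure below the [d] that absolute
    continuity attaches to [e']. The decrease charged to intervals inside [U] is then below [e'],
    the one charged to the slope is at most [e' * (b - a)], and together they stay below [e]. *)
Lemma abs_continuous_nondecreasing (R : realType) (a b : R) (g : R -> R) :
  a <= b -> abs_continuous a b g ->
  {ae @lebesgue_measure R, forall x, a < x < b ->
    exists2 d : R, is_derive x 1 g d & 0 <= d} ->
  g a <= g b.
Proof.
move=> ab acg [N [mN N0 hN]].
apply/ler_addgt0Pr => e e0.
pose e' := e / (1 + (b - a)).
have ba1 : 0 < 1 + (b - a) by lra.
have e'0 : 0 < e' by rewrite divr_gt0.
have [d d0 hd] := acg e' e'0.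
(* The endpoints join the exceptional set, since the hypothesis on the derivative concerns the open
   interval. *)
pose N' : set R := N `|` [set a; b].
have mN' : measurable N' by apply: measurableU => //; apply: measurableU.
have N'0 : @lebesgue_measure R N' = 0%E.
  apply: null_set_setU => //; first by apply: measurableU.
  by apply: null_set_setU => //; exact: lebesgue_measure_set1.
have N'fin : (@lebesgue_measure R N' < +oo)%E by rewrite N'0 ltry.
have [U [oU N'U muUN']] := lebesgue_regularity_outer mN' N'fin d0.
have mU : measurable U by exact: open_measurable.
have muU : (@lebesgue_measure R U < d%:E)%E.
  apply: le_lt_trans muUN'; rewrite -{1}(setDUK N'U).
  apply: le_trans (measureU2 _ _ _) _ => //; first exact: measurableD.
  by rewrite -[leRHS]add0e leeD2r //; rewrite le_eqVlt; apply/orP; left; apply/eqP; exact: N'0.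
have [|n [u [v [h1 h2 h3 h4]]]] := @decrease_on_open_cover R a b e' g U ab e'0 oU.
  move=> x xab nUx; apply: contrapT => nd; apply: nUx; apply: N'U.
  have [->|xa] := eqVneq x a; first by right; left.
  have [->|xb] := eqVneq x b; first by right; right.
  left; apply: hN => /= hx; apply/nd/hx.
  by case/andP: xab => ax xb'; rewrite !lt_neqAle eq_sym xa ax xb xb'.
have hS : \sum_(i < n) (v i - u i) < d.
  rewrite -lte_fin; apply: le_lt_trans muU.
  by apply: sum_length_le_measure => // i /h1[].
have := hd n (fun i => u i) (fun i => v i) _ (trivIset_ordered_itv h2) hS.
move=> /(_ (fun i => let: And3 x y z := h1 i (ltn_ord i) in
  conj x (conj y z))) hlt.
have : e' * (1 + (b - a)) = e by rewrite divfK // gt_eqF.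
lra.
Qed.

(** * Calculus of absolutely continuous functions *)

(** Common source of the closure properties below: the increments of a sum, a product or an
    exponential are dominated by those of its arguments. The denominator uses [L + 1] because [L]
    may vanish. *)
Lemma abs_continuous_dominated (R : realType) (a b L : R) (g g1 g2 : R -> R) :
  0 <= L -> abs_continuous a b g1 -> abs_continuous a b g2 ->
  (forall s t, a <= s -> s <= t -> t <= b ->
    `|g t - g s| <= L * (`|g1 t - g1 s| + `|g2 t - g2 s|)) ->
  abs_continuous a b g.
Proof.
move=> L0 ac1 ac2 dom e e0.
have e'0 : 0 < e / (2 * (L + 1)) by rewrite divr_gt0 // mulr_gt0 //; lra.
have [d1 d10 h1] := ac1 _ e'0; have [d2 d20 h2] := ac2 _ e'0.
exists (Num.min d1 d2) => [|n u v huv tuv]; first by rewrite lt_min d10.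
rewrite lt_min => /andP[s1 s2].
have {}h1 := h1 n u v huv tuv s1; have {}h2 := h2 n u v huv tuv s2.
apply: (@le_lt_trans _ _ (L * (\sum_(i < n) `|g1 (v i) - g1 (u i)| +
    \sum_(i < n) `|g2 (v i) - g2 (u i)|))).
  rewrite -big_split mulr_sumr; apply: ler_sum => i _.
  by have [? [? ?]] := huv i; exact: dom.
have eE : e = (L + 1) * (e / (2 * (L + 1)) + e / (2 * (L + 1))) by field; lra.
rewrite [ltRHS]eE; set A := (X in L * X); set B := (X in _ < _ * X).
have AB : A < B by exact: ltrD.
have B0 : 0 < B by exact: addr_gt0.
have : L * A <= L * B by rewrite ler_wpM2l // ltW.
lra.
Qed.

Lemma abs_continuous_lipschitz (R : realType) (a b L : R) (g : R -> R) :
  0 <= L ->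
  (forall s t, a <= s -> s <= t -> t <= b -> `|g t - g s| <= L * (t - s)) ->
  abs_continuous a b g.
Proof.
move=> L0 lip e e0; exists (e / (L + 1)) => [|n u v huv _ suv].
  by rewrite divr_gt0 //; lra.
apply: (@le_lt_trans _ _ (L * (\sum_(i < n) (v i - u i)))).
  rewrite mulr_sumr; apply: ler_sum => i _.
  by have [? [? ?]] := huv i; exact: lip.
have S0 : 0 <= \sum_(i < n) (v i - u i).
  by apply: sumr_ge0 => i _; have [_ [? _]] := huv i; rewrite subr_ge0.
have : e = (e / (L + 1)) * (L + 1) by rewrite divfK //; lra.
have : (\sum_(i < n) (v i - u i)) * (L + 1) < e / (L + 1) * (L + 1).
  by rewrite ltr_pM2r //; lra.
lra.
Qed.

Lemma abs_continuous_cst (R : realType) (a b c : R) : abs_continuous a b (fun=> c).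
Proof.
apply: (@abs_continuous_lipschitz _ _ _ 0) => // s t _ _ _.
by rewrite subrr normr0 mul0r.
Qed.

Lemma abs_continuous_id (R : realType) (a b : R) : abs_continuous a b id.
Proof.
apply: (@abs_continuous_lipschitz _ _ _ 1) => // s t _ st _.
by rewrite mul1r ger0_norm // subr_ge0.
Qed.

Lemma abs_continuousD (R : realType) (a b : R) (f g : R -> R) :
  abs_continuous a b f -> abs_continuous a b g ->
  abs_continuous a b (fun x => f x + g x).
Proof.
move=> acf acg; apply: (@abs_continuous_dominated _ _ _ 1 _ _ _ _ acf acg) => // s t _ _ _.
by rewrite mul1r opprD addrACA ler_normD.
Qed.

Lemma abs_continuousN (R : realType) (a b : R) (f : R -> R) :
  abs_continuous a b f -> abs_continuous a b (fun x => - f x).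
Proof.
move=> acf; apply: (@abs_continuous_dominated _ _ _ 1 _ _ _ _ acf acf) => // s t _ _ _.
by rewrite mul1r -opprD normrN lerDl.
Qed.

Lemma abs_continuousB (R : realType) (a b : R) (f g : R -> R) :
  abs_continuous a b f -> abs_continuous a b g ->
  abs_continuous a b (fun x => f x - g x).
Proof. by move=> acf acg; apply: abs_continuousD => //; exact: abs_continuousN. Qed.

Lemma abs_continuousS (R : realType) (a b c d : R) (f : R -> R) :
  a <= c -> d <= b -> abs_continuous a b f -> abs_continuous c d f.
Proof.
move=> ac db acf e /acf[r r0 hr]; exists r => // n u v huv; apply: hr => i.
have [cu [uv vd]] := huv i; split; first exact: le_trans cu.
by split=> //; exact: le_trans db.
Qed.

(** Over a length below the [d] attached to the tolerance 1, [f] moves by less than 1; interval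
    induction extends a bound [M] to [M + 1] at each step. *)
Lemma abs_continuous_bounded (R : realType) (a b : R) (f : R -> R) :
  a <= b -> abs_continuous a b f ->
  exists2 M : R, 0 <= M & forall x, a <= x <= b -> `|f x| <= M.
Proof.
move=> ab acf; have [d d0 hd] := acf 1 ltr01.
have near_ x y : a <= x -> x <= y -> y <= b -> y - x < d -> `|f y - f x| < 1.
  move=> ax xy yb yx.
  have := hd 1%N (fun=> x) (fun=> y); rewrite !big_ord1; apply => //.
  by move=> i j _ _ _; rewrite (ord1 i) (ord1 j).
pose P y := exists2 M : R, 0 <= M & forall x, a <= x <= y -> `|f x| <= M.
apply: (@closed_interval_induction R a b P ab).
  exists `|f a| => // x ax; have -> : x = a by apply/le_anti; rewrite andbC.
  by [].
move=> s sab; exists (d / 2) => [|x y ax yb sx xy ys _ _ [M M0 hM]].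
  by rewrite divr_gt0.
exists (M + 1) => [|z /andP[az zy]]; first by lra.
have [zx|xz] := leP z x; first by have := hM z; rewrite az zx => /(_ isT); lra.
have := near_ x z ax (ltW xz) (le_trans zy yb) ltac:(lra).
have := hM x; rewrite ax lexx => /(_ isT).
have := ler_normD (f z - f x) (f x); rewrite subrK; lra.
Qed.

Lemma abs_continuousM (R : realType) (a b : R) (f g : R -> R) :
  a <= b -> abs_continuous a b f -> abs_continuous a b g ->
  abs_continuous a b (fun x => f x * g x).
Proof.
move=> ab acf acg.
have [M M0 hM] := abs_continuous_bounded ab acf.
have [N N0 hN] := abs_continuous_bounded ab acg.
apply: (@abs_continuous_dominated _ _ _ (M + N) _ _ _ _ acf acg) => [|s t as_ st tb].
  by rewrite addr_ge0.
have -> : f t * g t - f s * g s = f t * (g t - g s) + (f t - f s) * g s by ring.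
have hft : `|f t| <= M by apply: hM; rewrite (le_trans as_).
have hgs : `|g s| <= N by apply: hN; rewrite as_ (le_trans st).
apply: (le_trans (ler_normD _ _)); rewrite !normrM.
have : `|f t| * `|g t - g s| <= M * `|g t - g s| by rewrite ler_wpM2r.
have : `|f t - f s| * `|g s| <= `|f t - f s| * N by rewrite ler_wpM2l.
have : 0 <= M * `|f t - f s| by rewrite mulr_ge0.
have : 0 <= N * `|g t - g s| by rewrite mulr_ge0.
lra.
Qed.

Lemma expR_lipschitz (R : realType) (M x y : R) :
  x <= M -> y <= M -> `|expR x - expR y| <= expR M * `|x - y|.
Proof.
wlog yx : x y / y <= x => [hw|xM yM].
  have [yx|/ltW xy] := leP y x; first exact: hw.
  by move=> xM yM; rewrite distrC [`|x - y|]distrC; exact: hw.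
rewrite !ger0_norm ?subr_ge0 ?ler_expR //.
have h := expR_ge1Dx (y - x).
have : expR x * (1 + (y - x)) <= expR x * expR (y - x) by rewrite ler_pM2l ?expR_gt0.
rewrite -expRD (addrC x) subrK.
have : expR x * (x - y) <= expR M * (x - y).
  by rewrite ler_wpM2r ?subr_ge0 // ler_expR.
lra.
Qed.

Lemma abs_continuous_expR (R : realType) (a b : R) (f : R -> R) :
  a <= b -> abs_continuous a b f -> abs_continuous a b (fun x => expR (f x)).
Proof.
move=> ab acf; have [M M0 hM] := abs_continuous_bounded ab acf.
apply: (@abs_continuous_dominated _ _ _ (expR M) _ _ _ _ acf acf) => [|s t as_ st tb].
  exact: expR_ge0.
have h x : a <= x <= b -> f x <= M by move=> /hM; apply: le_trans; exact: ler_norm.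
apply: (le_trans (@expR_lipschitz _ M _ _ _ _)).
- by apply: h; rewrite tb (le_trans as_).
- by apply: h; rewrite as_ (le_trans st).
- by rewrite ler_pM2l ?expR_gt0 // lerDl.
Qed.

(** * Complex-valued functions of a real variable *)

Section complex_parts.
Variable R : realType.
Implicit Types z w : R[i].

Lemma Re_add z w : complex.Re (z + w) = complex.Re z + complex.Re w.
Proof. by case: z w => [? ?] []. Qed.

Lemma Im_add z w : complex.Im (z + w) = complex.Im z + complex.Im w.
Proof. by case: z w => [? ?] []. Qed.

Lemma Re_opp z : complex.Re (- z) = - complex.Re z.
Proof. by case: z. Qed.

Lemma Im_opp z : complex.Im (- z) = - complex.Im z.
Proof. by case: z. Qed.

Lemma Re_mul z w : complex.Re (z * w) =
  complex.Re z * complex.Re w - complex.Im z * complex.Im w.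
Proof. by case: z w => [? ?] []. Qed.

Lemma Im_mul z w : complex.Im (z * w) =
  complex.Re z * complex.Im w + complex.Im z * complex.Re w.
Proof. by case: z w => [? ?] []. Qed.

Lemma complex_ext z w :
  complex.Re z = complex.Re w -> complex.Im z = complex.Im w -> z = w.
Proof. by case: z w => [? ?] [? ?] /= -> ->. Qed.

Lemma normc_ge0 z : 0 <= normc z.
Proof. by case: z => ? ?; exact: sqrtr_ge0. Qed.

Lemma normc_sqr z : normc z ^+ 2 = complex.Re z ^+ 2 + complex.Im z ^+ 2.
Proof. by case: z => ? ? /=; rewrite sqr_sqrtr // addr_ge0 // sqr_ge0. Qed.

Lemma normr_Re_le z : `|complex.Re z| <= normc z.
Proof.
rewrite -(@ler_pXn2r _ 2) ?nnegrE ?normc_ge0 // normc_sqr real_normK ?num_real //.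
by rewrite lerDl sqr_ge0.
Qed.

Lemma normr_Im_le z : `|complex.Im z| <= normc z.
Proof.
rewrite -(@ler_pXn2r _ 2) ?nnegrE ?normc_ge0 // normc_sqr real_normK ?num_real //.
by rewrite lerDr sqr_ge0.
Qed.

Lemma normc_le_ReIm z : normc z <= `|complex.Re z| + `|complex.Im z|.
Proof.
rewrite -(@ler_pXn2r _ 2) ?nnegrE ?normc_ge0 ?addr_ge0 // normc_sqr sqrrD.
rewrite !real_normK ?num_real // addrAC lerDl mulrn_wge0 // mulr_ge0 //.
Qed.

Lemma normcR (x : R) : normc x%:C = `|x|.
Proof. by rewrite /normc /= expr0n addr0 sqrtr_sqr. Qed.

Lemma normci : normc ('i%C : R[i]) = 1.
Proof. by rewrite /normc /= expr0n expr1n add0r sqrtr1. Qed.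

Lemma normc_normr z : `|z| = (normc z)%:C.
Proof. by case: z. Qed.

Lemma normcB z w : normc (z - w) <= normc z + normc w.
Proof. by rewrite (le_trans (le_normcD _ _)) // normcN. Qed.

Lemma normc_distrC z w : normc (z - w) = normc (w - z).
Proof. by rewrite -normcN opprB. Qed.

Lemma normcX z n : normc (z ^+ n) = normc z ^+ n.
Proof. by elim: n => [|n IH]; rewrite ?normc1 // !exprS normcM IH. Qed.

Lemma cexp0 : cexp (0 : R[i]) = 1.
Proof. by rewrite /cexp /= expR0 cos0 sin0 mul1r. Qed.

Lemma cexpD z w : cexp (z + w) = cexp z * cexp w.
Proof.
rewrite /cexp Re_add Im_add expRD cosD sinD; apply: complex_ext;
  rewrite !(Re_mul, Im_mul) /=; ring.
Qed.

Lemma cexpNK z : cexp z * cexp (- z) = 1.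
Proof. by rewrite -cexpD subrr cexp0. Qed.

Lemma normc_cexp z : normc (cexp z) = expR (complex.Re z).
Proof.
by rewrite normcM normcR ger0_norm ?expR_ge0 //= cos2Dsin2 sqrtr1 mulr1.
Qed.

Lemma is_cderiveD (f g : R -> R[i]) x df dg :
  is_cderive f x df -> is_cderive g x dg ->
  is_cderive (fun t => f t + g t) x (df + dg).
Proof.
move=> [f1 f2] [g1 g2]; split.
  rewrite Re_add (_ : (fun t => _) =
    (fun t => complex.Re (f t)) + (fun t => complex.Re (g t))).
    exact: is_deriveD.
  by apply/funext => t; rewrite Re_add.
rewrite Im_add (_ : (fun t => _) =
  (fun t => complex.Im (f t)) + (fun t => complex.Im (g t))).
  exact: is_deriveD.
by apply/funext => t; rewrite Im_add.
Qed.

Lemma is_cderiveM (f g : R -> R[i]) x df dg :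
  is_cderive f x df -> is_cderive g x dg ->
  is_cderive (fun t => f t * g t) x (df * g x + f x * dg).
Proof.
move=> [f1 f2] [g1 g2]; split.
  rewrite (_ : (fun t => _) =
    (fun t => complex.Re (f t)) * (fun t => complex.Re (g t)) -
    (fun t => complex.Im (f t)) * (fun t => complex.Im (g t))).
    apply: is_derive_eq; rewrite !(Re_add, Re_mul) /GRing.scale /=; ring.
  by apply/funext => t; rewrite Re_mul.
rewrite (_ : (fun t => _) =
  (fun t => complex.Re (f t)) * (fun t => complex.Im (g t)) +
  (fun t => complex.Im (f t)) * (fun t => complex.Re (g t))).
  apply: is_derive_eq; rewrite !(Im_add, Im_mul) /GRing.scale /=; ring.
by apply/funext => t; rewrite Im_mul.
Qed.

Lemma is_cderive_cst (c : R[i]) (x : R) : is_cderive (fun=> c) x 0.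
Proof. by split; exact: is_derive_cst. Qed.

Lemma is_cderive_cexp (c : R[i]) (x : R) :
  is_cderive (fun t => cexp (c * t%:C)) x (c * cexp (c * x%:C)).
Proof.
have lin (d : R) : is_derive x 1 (fun t : R => d * t) d.
  have := @is_deriveZ _ _ _ id d x 1 1 (is_derive_id _ _).
  by rewrite /GRing.scale /= mulr1.
have E := @is_derive1_comp _ expR _ x _ _ (is_derive_expR _) (lin (complex.Re c)).
have Co := @is_derive1_comp _ cos _ x _ _ (is_derive_cos _) (lin (complex.Im c)).
have Si := @is_derive1_comp _ sin _ x _ _ (is_derive_sin _) (lin (complex.Im c)).
have Rect t : complex.Re (c * t%:C) = complex.Re c * t by rewrite Re_mul /= mulr0 subr0.
have Imct t : complex.Im (c * t%:C) = complex.Im c * t by rewrite Im_mul /= mulr0 add0r.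
have Ree t : complex.Re (cexp (c * t%:C)) = expR (complex.Re c * t) * cos (complex.Im c * t).
  by rewrite /cexp Re_mul /= Rect Imct mul0r subr0.
have Ime t : complex.Im (cexp (c * t%:C)) = expR (complex.Re c * t) * sin (complex.Im c * t).
  by rewrite /cexp Im_mul /= Rect Imct mul0r addr0.
split.
  rewrite (_ : (fun t => _) = (expR \o (fun t => complex.Re c * t)) *
     (cos \o (fun t => complex.Im c * t))); last exact/funext.
  by apply: is_derive_eq; rewrite Re_mul Ree Ime /GRing.scale /=; ring.
rewrite (_ : (fun t => _) = (expR \o (fun t => complex.Re c * t)) *
   (sin \o (fun t => complex.Im c * t))); last exact/funext.
by apply: is_derive_eq; rewrite Im_mul Ree Ime /GRing.scale /=; ring.
Qed.

Lemma cabs_continuousD (a b : R) (f g : R -> R[i]) :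
  cabs_continuous a b f -> cabs_continuous a b g ->
  cabs_continuous a b (fun x => f x + g x).
Proof.
move=> [f1 f2] [g1 g2]; split.
  under eq_fun do rewrite Re_add.
  exact: (abs_continuousD f1 g1).
under eq_fun do rewrite Im_add.
exact: (abs_continuousD f2 g2).
Qed.

Lemma cabs_continuousM (a b : R) (f g : R -> R[i]) : a <= b ->
  cabs_continuous a b f -> cabs_continuous a b g ->
  cabs_continuous a b (fun x => f x * g x).
Proof.
move=> ab [f1 f2] [g1 g2]; split.
  under eq_fun do rewrite Re_mul.
  exact: (abs_continuousB (abs_continuousM ab f1 g1) (abs_continuousM ab f2 g2)).
under eq_fun do rewrite Im_mul.
exact: (abs_continuousD (abs_continuousM ab f1 g2) (abs_continuousM ab f2 g1)).
Qed.

Lemma cabs_continuousS (a b c d : R) (f : R -> R[i]) :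
  a <= c -> d <= b -> cabs_continuous a b f -> cabs_continuous c d f.
Proof. by move=> ac db [? ?]; split; exact: (abs_continuousS ac db). Qed.

Lemma cabs_continuous_cst (a b : R) (c : R[i]) : cabs_continuous a b (fun=> c).
Proof. by split; exact: abs_continuous_cst. Qed.

Lemma cabs_continuous_cexp (a b : R) (c : R[i]) : a <= b ->
  cabs_continuous a b (fun t => cexp (c * t%:C)).
Proof.
move=> ab.
(* [M] bounds the real part of [c t] on [[a, b]], so [L] is a Lipschitz constant there by the mean
   value theorem. *)
pose M := `|complex.Re c| * (`|a| + `|b|).
pose L := normc c * expR M.
have L0 : 0 <= L by rewrite mulr_ge0 ?normc_ge0 ?expR_ge0.
have dL t : a <= t <= b -> normc (c * cexp (c * t%:C)) <= L.
  move=> /andP[at_ tb]; rewrite normcM ler_wpM2l ?normc_ge0 //.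
  rewrite normc_cexp ler_expR Re_mul /= mulr0 subr0 (le_trans (ler_norm _)) //.
  rewrite normrM ler_wpM2l // ler_norml.
  have := ler_norm b; have := ler_norm (- a); rewrite normrN.
  have := normr_ge0 a; have := normr_ge0 b; lra.
split; apply: (@abs_continuous_lipschitz _ _ _ L) => // s t as_ st tb.
- have [||r rst ->] := @MVT_segment _ (fun t => complex.Re (cexp (c * t%:C)))
    (fun t => complex.Re (c * cexp (c * t%:C))) _ _ st.
  + by move=> x _; have [] := is_cderive_cexp c x.
  + apply: continuous_subspaceT => x; apply: differentiable_continuous.
    by apply/derivable1_diffP; have [[]] := is_cderive_cexp c x.
  + rewrite normrM (ger0_norm (_ : 0 <= t - s)) ?subr_ge0 // ler_wpM2r ?subr_ge0 //.
    apply: (le_trans (normr_Re_le _)); apply: dL.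
    by move: rst; rewrite in_itv /= => /andP[sr rt]; rewrite (le_trans as_) // (le_trans rt).
- have [||r rst ->] := @MVT_segment _ (fun t => complex.Im (cexp (c * t%:C)))
    (fun t => complex.Im (c * cexp (c * t%:C))) _ _ st.
  + by move=> x _; have [] := is_cderive_cexp c x.
  + apply: continuous_subspaceT => x; apply: differentiable_continuous.
    by apply/derivable1_diffP; have [_ []] := is_cderive_cexp c x.
  + rewrite normrM (ger0_norm (_ : 0 <= t - s)) ?subr_ge0 // ler_wpM2r ?subr_ge0 //.
    apply: (le_trans (normr_Im_le _)); apply: dL.
    by move: rst; rewrite in_itv /= => /andP[sr rt]; rewrite (le_trans as_) // (le_trans rt).
Qed.

(** Substitute for bounding an integral: [h] is a primitive of a majorant of [|p'|]. Each of the
    real and imaginary parts [f] is handled through the monotonicity of [h - f] and [h + f]; adding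
    the two parts costs the factor 2 that recurs in the later constants. *)
Lemma normc_increment_le (a b : R) (p : R -> R[i]) (h : R -> R) :
  a <= b -> cabs_continuous a b p -> abs_continuous a b h ->
  {ae @lebesgue_measure R, forall x, a < x < b ->
    exists2 p', is_cderive p x p' & exists2 h', is_derive x 1 h h' & normc p' <= h'} ->
  normc (p b - p a) <= 2 * (h b - h a).
Proof.
move=> ab [ac1 ac2] ach hae.
have real_le (f : R -> R) : abs_continuous a b f ->
    {ae @lebesgue_measure R, forall x, a < x < b ->
      exists2 f', is_derive x 1 f f' & exists2 h', is_derive x 1 h h' & `|f'| <= h'} ->
    `|f b - f a| <= h b - h a.
  move=> acf fae; rewrite ler_norml.
  have le1 : h a - f a <= h b - f b.
    apply: (@abs_continuous_nondecreasing _ _ _ (fun x => h x - f x) ab).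
      exact: (abs_continuousB ach acf).
    apply: ae_imply fae => x hx /hx[f' df [h' dh fh]].
    exists (h' - f'); first exact: (@is_deriveB _ _ _ h f x 1 h' f' dh df).
    by rewrite subr_ge0 (le_trans (ler_norm _)).
  have le2 : h a + f a <= h b + f b.
    apply: (@abs_continuous_nondecreasing _ _ _ (fun x => h x + f x) ab).
      exact: (abs_continuousD ach acf).
    apply: ae_imply fae => x hx /hx[f' df [h' dh fh]].
    exists (h' + f'); first exact: (@is_deriveD _ _ _ h f x 1 h' f' dh df).
    by have := ler_norm (- f'); rewrite normrN; lra.
  lra.
apply: (le_trans (normc_le_ReIm _)); rewrite !(Re_add, Im_add, Re_opp, Im_opp).
rewrite mulr_natl mulr2n; apply: lerD.
- apply: (real_le (fun t => complex.Re (p t)) ac1).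
  apply: ae_imply hae => x hx /hx[p' [d1 d2] [h' dh ph]].
  exists (complex.Re p') => //; exists h' => //.
  exact: le_trans (normr_Re_le _) _.
- apply: (real_le (fun t => complex.Im (p t)) ac2).
  apply: ae_imply hae => x hx /hx[p' [d1 d2] [h' dh ph]].
  exists (complex.Im p') => //; exists h' => //.
  exact: le_trans (normr_Im_le _) _.
Qed.

End complex_parts.

(** * Tails of the potential *)

Lemma integrable_tail (R : realType) (f : R -> R) : (forall x : R, 0 <= f x) ->
  (@lebesgue_measure R).-integrable [set: R] (EFin \o f) ->
  exists T : R -> R,
    [/\ forall a b, abs_continuous a b T,
        {ae @lebesgue_measure R, forall x : R, is_derive x 1 T (- f x)},
        forall x : R, 0 <= T x &
        forall e : R, 0 < e -> exists2 A : R, 0 <= A & forall x, A <= x -> T x <= e].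
Proof.
move=> f0 intf; set mu := @lebesgue_measure R.
have intS (i : interval R) : mu.-integrable [set` i] (EFin \o f).
  by apply: (integrableS _ _ _ intf) => //.
pose F (y : R) := (\int[mu]_(t in `]-oo, y]) f t)%R.
have FB (u v : R) : u <= v -> F v - F u = \int[mu]_(t in `]u, v[) f t.
  move=> uv; rewrite /F Rintegral_itvB ?bnd_simp //.
  by rewrite -Rintegral_itv_bndo_bndc.
have Fnd (u v : R) : u <= v -> F u <= F v.
  by move=> uv; rewrite -subr_ge0 FB // Rintegral_ge0.
have Fub (y : R) : F y <= \int[mu]_t f t.
  rewrite /F /Rintegral; apply: fine_le.
  - exact: (integrable_fin_num _ (intS _)).
  - exact: (integrable_fin_num _ intf).
  apply: ge0_subset_integral => //; first by case/integrableP: intf.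
  by move=> x _; rewrite /= lee_fin.
have hS : has_sup (range F).
  split; first by exists (F 0); exists 0.
  by exists (\int[mu]_t f t) => _ [y _ <-].
(* Measuring the tail from the supremum of [F] makes its nonnegativity and its smallness at infinity
   direct properties of the supremum. *)
pose T x := sup (range F) - F x.
exists T; split.
- move=> a b; rewrite /T; apply: abs_continuousB; first exact: abs_continuous_cst.
  move=> e e0; have [d [d0 hd]] := integral_normr_continuous intf e0.
  exists d => // n u v huv tuv suv.
  have mI (i : 'I_n) : measurable (`]u i, v i[%classic : set R) by exact: measurable_itv.
  (* The sum of the increments of [F] is the integral of [f] over this disjoint union, which is
     small because the union has small measure. *)
  pose A := \big[setU/set0]_(i < n) `]u i, v i[%classic.
  have mA : measurable A by exact: bigsetU_measurable.
  have uvi i : u i <= v i by have [_ []] := huv i.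
  have muA : (mu A < d%:E)%E.
    rewrite /mu (@measure_bigsetU_ord _ _ _ lebesgue_measure n predT
      (fun i => `]u i, v i[%classic)) //.
    rewrite (eq_bigr (fun i => (v i - u i)%:E)); last first.
      by move=> i _; exact: lebesgue_measure_oo.
    by rewrite sumEFin lte_fin.
  have := hd A mA muA; congr (_ < _).
  rewrite (_ : \int[mu]_(x in A) `|f x| = \int[mu]_(x in A) f x); last first.
    by apply: eq_Rintegral => x _; rewrite ger0_norm.
  rewrite /Rintegral (@ge0_integral_bigsetU _ _ _ mu _ _ (EFin \o f) (index_enum _)) //.
  + rewrite -EFin_sum_fine => [|i _]; last exact/integrable_fin_num/intS.
    apply: eq_bigr => i _ /=.
    by rewrite FB // ger0_norm ?Rintegral_ge0.
  + exact: index_enum_uniq.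
  + exact: sub_trivIset tuv.
  + by case/integrableP: intf => mf _; apply: (measurable_funS _ _ mf).
  + by move=> x _; rewrite /= lee_fin.
- have := FTC1Ny (fun y => intS `]-oo, y]) (open_integrable_locally openT intf).
  apply: ae_imply => x [dF F'].
  have dFx : is_derive x 1 F (f x).
    by apply: DeriveDef; [exact: dF | rewrite -derive1E].
  by have := @is_deriveB _ _ _ (cst (sup (range F))) F x 1 0 (f x)
    (is_derive_cst _ _ _) dFx; rewrite sub0r.
- by move=> x; rewrite subr_ge0; apply: ub_le_sup; [case: hS | exists x].
- move=> e e0; have [_ [x _ <-] hx] := sup_adherent e0 hS.
  exists (Num.max 0 x) => [|y]; first by rewrite le_max lexx.
  by rewrite ge_max => /andP[_ /Fnd]; rewrite /T; lra.
Qed.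

(* [T] and [U] play the roles of the tail integrals of [|q|] and of [x |q x|]. *)
Definition tail_pair (R : realType) (q T U : R -> R) : Prop :=
  [/\ forall a b, abs_continuous a b T /\ abs_continuous a b U,
      {ae @lebesgue_measure R, forall x : R, 0 < x ->
        is_derive x 1 T (- `|q x|) /\ is_derive x 1 U (- (x * `|q x|))},
      forall x : R, 0 <= T x /\ 0 <= U x,
      forall x : R, 0 <= x -> x * T x <= U x &
      forall e : R, 0 < e -> exists2 A : R, 0 <= A & forall x, A <= x -> U x <= e].

Lemma tail_pair_exists (R : realType) (q : R -> R) :
  L11 q -> exists T U : R -> R, tail_pair q T U.
Proof.
have fE (w z : R) : z != 0 -> z * (w / (2 * z)) = w / 2 by move=> z0; field.
move=> [mq qfin _]; set D : set R := `[0, +oo[%classic.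
have mD : measurable D by exact: measurable_itv.
have m0 : measurable_fun D (fun x => (1 + x) * `|q x|).
  apply: measurable_funM; first by apply: measurable_funD => //; exact: measurable_cst.
  exact: measurableT_comp.
have int0 : (@lebesgue_measure R).-integrable D (EFin \o (fun x => (1 + x) * `|q x|)).
  apply/integrableP; split; first exact/measurable_EFinP.
  apply: le_lt_trans qfin; apply: ge0_le_integral => //=.
  - by apply/measurable_EFinP; exact: measurableT_comp.
  - exact/measurable_EFinP.
  - move=> x; rewrite /D /= in_itv/= andbT => x0.
    by rewrite lee_fin ger0_norm // mulr_ge0 // addr_ge0.
(* The tails are built on the whole line, so the densities are extended by zero to negative
   arguments. *)
have intD (g : R -> R) : measurable_fun D g ->
    (forall x, 0 <= x -> 0 <= g x <= (1 + x) * `|q x|) ->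
    (@lebesgue_measure R).-integrable [set: R] (EFin \o (g \_ D)).
  move=> mg hg; rewrite -restrict_EFin; have [h _] := @integrable_mkcond _ _ _ lebesgue_measure D (EFin \o g) mD; apply: h.
  apply: le_integrable int0 => //; first exact/measurable_EFinP.
  move=> x; rewrite /D /= in_itv/= andbT => x0.
  have /andP[g0 gle] := hg x x0.
  by rewrite /= lee_fin (ger0_norm g0) ger0_norm // (le_trans g0 gle).
have restr0 (g : R -> R) : (forall x, 0 <= x -> 0 <= g x) -> forall x, 0 <= (g \_ D) x.
  move=> g0 x; rewrite patchE; case: ifPn => //; rewrite inE /D /= in_itv/= andbT.
  exact: g0.
have mabs : measurable_fun D (fun x => `|q x|) by exact: measurableT_comp.
have [||T [acT dT T0 limT]] := @integrable_tail R ((fun x => `|q x|) \_ D).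
- by apply: restr0.
- apply: intD => // x x0; rewrite normr_ge0 /= mulrDl mul1r lerDl mulr_ge0 //.
have [||U [acU dU U0 limU]] := @integrable_tail R ((fun x => x * `|q x|) \_ D).
- by apply: restr0 => x x0; rewrite mulr_ge0.
- apply: intD; first by apply: measurable_funM => //.
  move=> x x0; rewrite mulr_ge0 //= mulrDl mul1r lerDr //.
have dTU : {ae @lebesgue_measure R, forall x : R, 0 < x ->
    is_derive x 1 T (- `|q x|) /\ is_derive x 1 U (- (x * `|q x|))}.
  apply: ae_imply2 dT dU => x dTx dUx x0.
  have xD : x \in D by rewrite inE /D /= in_itv/= andbT ltW.
  by move: dTx dUx; rewrite !patchE xD.
exists T, U; split=> // x x0.
(* For fixed [x], the function [x * T t - U t] of [t >= x] has derivative [(t - x) * |q t| >= 0]. A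
   positive value at [t = x] would persist for all larger [t], although [T] tends to 0 and [U] is
   nonnegative. The denominator uses [x + 1] to allow [x = 0]. *)
rewrite leNgt; apply/negP => hlt.
have e0 : 0 < (x * T x - U x) / (2 * (x + 1)) by rewrite divr_gt0 //; lra.
have [A A0 hA] := limT _ e0.
pose X := Num.max A x.
have xX : x <= X by rewrite le_max lexx orbT.
have TX : T X <= (x * T x - U x) / (2 * (x + 1)) by apply: hA; rewrite le_max lexx.
have : x * T x - U x <= x * T X - U X.
  apply: (@abs_continuous_nondecreasing _ _ _ (fun t : R => x * T t - U t) xX).
    apply: abs_continuousB => //; apply: abs_continuousM => //.
    exact: abs_continuous_cst.
  apply: ae_imply dTU => t h /andP[xt tX]; have [dTt dUt] := h (le_lt_trans x0 xt).
  exists (x * (- `|q t|) - - (t * `|q t|)).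
    by apply: (@is_deriveB _ _ _ (x *: T) U); exact: is_deriveZ.
  by rewrite opprK mulrN addrC subr_ge0 ler_wpM2r // ltW.
have : x * T X <= (x + 1) * ((x * T x - U x) / (2 * (x + 1))).
  apply: (@le_trans _ _ ((x + 1) * T X)).
    by rewrite ler_wpM2r // lerDl.
  by rewrite ler_wpM2l //; lra.
rewrite fE; last by rewrite gt_eqF //; lra.
have := U0 X; lra.
Qed.

(** * The Schrodinger equation *)

(** The derivative is a named companion because amplitudes and Wronskians use its values, and the
    second derivative is replaced by what the equation says it is. *)
Definition schrodinger_pair (R : realType) (q : R -> R) (z : R[i])
    (y y' : R -> R[i]) : Prop :=
  [/\ forall x : R, 0 < x -> is_cderive y x (y' x),
      forall a b : R, 0 <= a -> cabs_continuous a b y /\ cabs_continuous a b y' &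
      {ae @lebesgue_measure R, forall x : R, 0 < x ->
        is_cderive y' x (((q x)%:C - z) * y x)}].

Lemma schrodinger_solution_pair (R : realType) (q : R -> R) (z : R[i]) (y : R -> R[i]) :
  schrodinger_solution q z y -> exists y', schrodinger_pair q z y y'.
Proof.
move=> [y' [h1 h2 h3]]; exists y'; split => //.
  move=> a b a0; have [|c1 c2] := h2 (Num.max b 1); first by rewrite lt_max ltr01 orbT.
  by split; [apply: cabs_continuousS c1 | apply: cabs_continuousS c2];
    rewrite // le_max lexx.
apply: ae_imply h3 => x h x0; have [y2 dy2 e] := h x0.
by have -> : ((q x)%:C - z) * y x = y2 by rewrite mulrBl -e opprD opprK addrCA subrr addr0.
Qed.

Lemma dot_le_normc (R : realType) (z w : R[i]) :
  `|complex.Re z * complex.Re w + complex.Im z * complex.Im w| <= normc z * normc w.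
Proof.
rewrite -(@ler_pXn2r _ 2) ?nnegrE ?mulr_ge0 ?normc_ge0 // real_normK ?num_real //.
rewrite exprMn !normc_sqr -subr_ge0.
set a := complex.Re z; set b := complex.Im z; set c := complex.Re w; set d := complex.Im w.
have -> : (a ^+ 2 + b ^+ 2) * (c ^+ 2 + d ^+ 2) - (a * c + b * d) ^+ 2 =
  (a * d - b * c) ^+ 2 by ring.
exact: sqr_ge0.
Qed.

(* Gronwall in both directions: the energy [E] satisfies [|E'| <= (2 + |q|) E],
   and [2x - T x] is a primitive of [2 + |q|]. *)
Lemma energy_gronwall (R : realType) (q T U : R -> R) (z : R[i]) (y y' : R -> R[i]) :
  tail_pair q T U -> schrodinger_pair q z y y' -> normc z <= 1 ->
  let E x := normc (y x) ^+ 2 + normc (y' x) ^+ 2 in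
  forall a b : R, 0 <= a -> a <= b ->
  E b <= E a * expR (2 * (b - a) + (T a - T b)) /\
  E a <= E b * expR (2 * (b - a) + (T a - T b)).
Proof.
move=> [acTU dTU _ _ _] [dy acy dy'] z1 E a b a0 ab.
have acT := (acTU a b).1.
have dT : {ae @lebesgue_measure R, forall x : R, 0 < x -> is_derive x 1 T (- `|q x|)}.
  by apply: ae_imply dTU => x h /h[].
have dsum (f1 f2 g1 g2 : R -> R) (x d1 d2 e1 e2 : R) :
    is_derive x 1 f1 d1 -> is_derive x 1 f2 d2 ->
    is_derive x 1 g1 e1 -> is_derive x 1 g2 e2 ->
    is_derive x 1 ((f1 * f1 + f2 * f2) + (g1 * g1 + g2 * g2))
      (2 * ((f1 x * d1 + f2 x * d2) + (g1 x * e1 + g2 x * e2))).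
  have dsq (f : R -> R) (d : R) : is_derive x 1 f d -> is_derive x 1 (f * f) (2 * (f x * d)).
    by move=> h; have := is_deriveM h h; rewrite -mulr2n mulr_natl.
  move=> /dsq h1 /dsq h2 /dsq h3 /dsq h4; rewrite !mulrDr.
  exact: (is_deriveD (is_deriveD h1 h2) (is_deriveD h3 h4)).
pose f1 t := complex.Re (y t); pose f2 t := complex.Im (y t).
pose g1 t := complex.Re (y' t); pose g2 t := complex.Im (y' t).
have EE : E = (f1 * f1 + f2 * f2) + (g1 * g1 + g2 * g2).
  by apply/funext => t; rewrite /E !normc_sqr !expr2.
have [[ac1 ac2] [ac3 ac4]] := acy a b a0.
have acE : abs_continuous a b E.
  rewrite EE; apply: abs_continuousD; apply: abs_continuousD; exact: abs_continuousM.
have E0 x : 0 <= E x by rewrite addr_ge0 // sqr_ge0.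
have dE : {ae @lebesgue_measure R, forall x : R, 0 < x ->
    exists2 d, is_derive x 1 E d & `|d| <= (2 + `|q x|) * E x}.
  apply: ae_imply dy' => x h x0; have [y1 y2] := dy x x0; have [y3 y4] := h x0.
  set w := ((q x)%:C - z) * y x in y3 y4.
  exists (2 * ((f1 x * complex.Re (y' x) + f2 x * complex.Im (y' x)) +
               (g1 x * complex.Re w + g2 x * complex.Im w))).
    by rewrite EE; exact: dsum.
  rewrite normrM (ger0_norm (ler0n _ 2)).
  have nw : normc w <= (`|q x| + 1) * normc (y x).
    rewrite normcM ler_wpM2r ?normc_ge0 // (le_trans (normcB _ _)) //.
    by rewrite normcR lerD2l.
  have h1 := dot_le_normc (y x) (y' x); have h2 := dot_le_normc (y' x) w.
  have h3 := ler_normD (f1 x * complex.Re (y' x) + f2 x * complex.Im (y' x))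
               (g1 x * complex.Re w + g2 x * complex.Im w).
  have h4 : normc (y' x) * normc w <= normc (y' x) * ((`|q x| + 1) * normc (y x)).
    by rewrite ler_wpM2l ?normc_ge0.
  (* This square is the inequality of arithmetic and geometric means, which turns the product
     [|y| |y'|] into the energy. *)
  have h5 : 0 <= (2 + `|q x|) * (normc (y x) - normc (y' x)) ^+ 2.
    by rewrite mulr_ge0 ?addr_ge0 ?sqr_ge0.
  apply: (@le_trans _ _ (2 * ((2 + `|q x|) * (normc (y x) * normc (y' x))))).
    rewrite ler_pM2l //; apply: (le_trans h3); apply: (le_trans (lerD h1 h2)).
    apply: (le_trans (lerD (lexx _) h4)).
    by rewrite le_eqVlt; apply/orP; left; apply/eqP; ring.
  rewrite -subr_ge0; move: h5; congr (0 <= _); rewrite /E; ring.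
pose H x := 2 * x - T x.
have acH c : abs_continuous a b (fun x => c * H x).
  apply: abs_continuousM => //; first exact: abs_continuous_cst.
  apply: abs_continuousB => //; apply: abs_continuousM => //.
    exact: abs_continuous_cst.
  exact: abs_continuous_id.
have HE : 2 * (b - a) + (T a - T b) = H b - H a by rewrite /H; ring.
(* The sign [c] treats both directions at once: [c = 1] says that [E * expR H] does not decrease,
   [c = -1] that [E * expR (- H)] does not increase. *)
have dG (c : R) : `|c| = 1 -> {ae @lebesgue_measure R, forall x, a < x < b ->
    exists2 d : R, is_derive x 1 (fun t => c * (E t * expR (c * H t))) d & 0 <= d}.
  move=> c1; apply: ae_imply2 dE dT => x hE hT /andP[ax _].
  have x0 : 0 < x by exact: le_lt_trans ax.
  have [d dEx dle] := hE x0; have dTx := hT x0.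
  have dH : is_derive x 1 (fun t => c * H t) (c * (2 + `|q x|)).
    have -> : (fun t => c * H t) = c *: (2 *: id - T) by [].
    by apply: is_derive_eq; rewrite /GRing.scale /= mulr1 opprK.
  have dexp := @is_derive1_comp _ expR _ x _ _ (is_derive_expR _) dH.
  exists (expR (c * H x) * (c * d + c ^+ 2 * ((2 + `|q x|) * E x))).
    have -> : (fun t => c * (E t * expR (c * H t))) =
      c *: (E * (expR \o (fun t => c * H t))) by [].
    by apply: is_derive_eq; rewrite /GRing.scale /=; ring.
  rewrite mulr_ge0 ?expR_ge0 // -(real_normK (num_real c)) c1 expr1n mul1r.
  have := ler_norm (- (c * d)); rewrite normrN normrM c1 mul1r; lra.
have mono c : `|c| = 1 -> c * (E a * expR (c * H a)) <= c * (E b * expR (c * H b)).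
  move=> c1; apply: (@abs_continuous_nondecreasing _ _ _
    (fun t => c * (E t * expR (c * H t))) ab); last exact: dG.
  apply: abs_continuousM => //; first exact: abs_continuous_cst.
  by apply: abs_continuousM => //; exact: abs_continuous_expR.
have cancel (u v s t : R) : v * expR (- t) <= u * expR (- s) -> v <= u * expR (t - s).
  move=> h; rewrite addrC expRD mulrA -[leLHS]mulr1 -expR0 -(addNr t) expRD mulrA.
  by rewrite ler_pM2r ?expR_gt0.
rewrite HE; split.
  by apply: cancel; have := mono (-1); rewrite normrN1 !mulN1r lerN2; apply.
have -> : H b - H a = - H a - (- H b) by rewrite opprK addrC.
by apply: cancel; have := mono 1; rewrite normr1 !mul1r !opprK; apply.
Qed.

(** * Uniform bounds on the Jost solutions *)

(** This is the factor [m] of [y = m e^(c x)]. From here on [c] stands for [i k]: the half-plane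
    [Im k >= 0] becomes [Re c <= 0], and the spectral parameter [k^2] becomes [- c ^+ 2]. *)
Definition amplitude (R : realType) (c : R[i]) (y : R -> R[i]) (x : R) : R[i] :=
  y x * cexp (- c * x%:C).

Definition amplitude_tends_to_1 (R : realType) (c : R[i]) (y : R -> R[i]) : Prop :=
  forall e : R, 0 < e -> exists X : R, forall x : R, X <= x -> normc (amplitude c y x - 1) <= e.

Definition amplitude' (R : realType) (c : R[i]) (y y' : R -> R[i]) (x : R) : R[i] :=
  (y' x - c * y x) * cexp (- c * x%:C).

Section amplitude.
Variables (R : realType) (q T U : R -> R).
Hypothesis tail : tail_pair q T U.
Implicit Types (c d : R[i]) (y : R -> R[i]) (a b x : R).

Lemma is_cderive_amplitude c y y' x :
  is_cderive y x (y' x) -> is_cderive (amplitude c y) x (amplitude' c y y' x).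
Proof.
move=> dy; have -> : amplitude' c y y' x =
    y' x * cexp (- c * x%:C) + y x * (- c * cexp (- c * x%:C)).
  by rewrite /amplitude'; ring.
exact: is_cderiveM dy (is_cderive_cexp (- c) x).
Qed.

Lemma cabs_continuous_amplitude c z y y' a b :
  schrodinger_pair q z y y' -> 0 <= a -> a <= b ->
  cabs_continuous a b (amplitude c y).
Proof.
move=> [_ acy _] a0 ab; apply: cabs_continuousM => //; first by have [] := acy a b a0.
exact: cabs_continuous_cexp.
Qed.

(* The equation [y'' = (q + d^2) y] is [((y' + d y) e^(-d x))' = q y e^(-d x)]. *)
Lemma factored_increment_le d y y' a b M :
  schrodinger_pair q (- d ^+ 2) y y' -> 0 <= a -> a <= b ->
  (forall x, a <= x <= b -> normc (y x * cexp (- d * x%:C)) <= M) ->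
  normc ((y' b + d * y b) * cexp (- d * b%:C) - (y' a + d * y a) * cexp (- d * a%:C))
    <= 2 * M * (T a - T b).
Proof.
move=> [dy acy dy'] a0 ab hM; have [acTU dTU _ _ _] := tail.
have [acyab acy'ab] := acy a b a0.
have -> : 2 * M * (T a - T b) = 2 * (- M * T b - - M * T a) by ring.
apply: (@normc_increment_le _ a b
  (fun x => (y' x + d * y x) * cexp (- d * x%:C)) (fun x => - M * T x)) => //.
- apply: cabs_continuousM => //; last exact: cabs_continuous_cexp.
  apply: cabs_continuousD => //; apply: cabs_continuousM => //.
  exact: cabs_continuous_cst.
- apply: abs_continuousM => //; first exact: abs_continuous_cst.
  by have [] := acTU a b.
- apply: ae_imply2 dy' dTU => x h1 h2 /andP[ax xb].
  have x0 : 0 < x by exact: le_lt_trans ax.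
  have [dTx _] := h2 x0.
  exists ((q x)%:C * (y x * cexp (- d * x%:C))).
    have D := is_cderiveM (is_cderiveD (h1 x0) (is_cderiveM (is_cderive_cst d x) (dy x x0)))
      (is_cderive_cexp (- d) x).
    move: D; congr (is_cderive _ _ _); ring.
  exists (- M * - `|q x|); first exact: (@is_deriveZ _ _ _ T (- M) x 1 _ dTx).
  rewrite mulrNN normcM normcR (mulrC M) ler_wpM2l // hM // (ltW ax) (ltW xb) //.
Qed.

Lemma T_small e : 0 < e -> exists2 A : R, 0 < A & forall x, A <= x -> T x <= e.
Proof.
have [_ _ TU0 xTU limU] := tail => /limU[A A0 hA].
exists (A + 1) => [|x Ax]; first by lra.
have x1 : 1 <= x by lra.
apply: le_trans (hA x _); last by lra.
apply: le_trans (xTU x _); last by lra.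
by rewrite ler_peMl // (TU0 x).1.
Qed.

(** The case [d = c] of the factored equation bounds the increments of [m' + 2 c m]. As [m] tends to
    1, [m'] is therefore nearly constant far out, and since [m] barely changes over a unit step,
    that constant must be small. *)
Lemma amplitude'_small c y y' :
  schrodinger_pair q (- c ^+ 2) y y' ->
  amplitude_tends_to_1 c y ->
  forall e : R, 0 < e -> exists2 X, 0 < X &
    forall x, X <= x -> normc (amplitude' c y y' x) <= e.
Proof.
move=> sp lim e e0; have [dy acy dy'] := sp.
set m := amplitude c y; set m' := amplitude' c y y'.
have nc := normc_ge0 c.
have n0 : 0 < e / (32 * (normc c + 1)) by rewrite divr_gt0 //; lra.
have [X1 hX1] := lim _ n0; have [X2 hX2] := lim 1 ltr01.
have e32 : 0 < e / 32 by rewrite divr_gt0.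
have [X3 X30 hX3] := T_small e32.
pose X := Num.max X1 (Num.max X2 X3).
have X0 : 0 < X by rewrite !lt_max X30 !orbT.
exists X => // t; rewrite !ge_max => /and3P[X1t X2t X3t].
have t0 : 0 < t by exact: lt_le_trans X3t.
have tt1 : t <= t + 1 by lra.
have small x : t <= x -> normc (m x - 1) <= e / (32 * (normc c + 1)).
  by move=> tx; apply/hX1/(le_trans X1t).
have cme x : t <= x -> normc c * normc (m x - 1) <= e / 32.
  move=> tx; apply: le_trans (_ : (normc c + 1) * (e / (32 * (normc c + 1))) <= _).
    by apply: ler_pM => //; rewrite ?normc_ge0 ?lerDl ?small.
  rewrite le_eqVlt; apply/orP; left; apply/eqP; field; lra.
have me x : t <= x -> normc (m x - 1) <= e / 32.
  move=> tx; apply: (le_trans (small x tx)).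
  by rewrite ler_pM2l // lef_pV2 ?posrE //; lra.
have bnd x : t <= x -> normc (m x) <= 2.
  move=> tx; rewrite -(subrK 1 (m x)) (le_trans (le_normcD _ _)) // normc1.
  by have := hX2 x (le_trans X2t tx); rewrite -/m; lra.
have m'm' x : t <= x -> normc (m' x - m' t) <= e / 4.
  move=> tx.
  have -> : m' x - m' t =
    ((y' x + c * y x) * cexp (- c * x%:C) - (y' t + c * y t) * cexp (- c * t%:C)) +
    (2 * (c * (m t - 1)) - 2 * (c * (m x - 1))).
    by rewrite /m /m' /amplitude /amplitude'; ring.
  have h1 := @factored_increment_le c y y' t x 2 sp (ltW t0) tx.
  have {}h1 := h1 (fun z h => bnd z (andP h).1).
  have Tt := hX3 t X3t; have [_ _ TU0 _ _] := tail; have [Tx _] := TU0 x.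
  have n2 : normc (2 : R[i]) = 2.
    have -> : (2 : R[i]) = (2 : R)%:C by rewrite -(rmorph_nat (real_complex R)).
    by rewrite normcR ger0_norm.
  have h2 := cme x tx; have h3 := cme t (lexx _).
  apply: (le_trans (le_normcD _ _)); apply: (le_trans (lerD h1 (normcB _ _))).
  by rewrite !normcM n2; lra.
(* Subtracting the linear function of slope [m' t] leaves a function whose derivative is the small
   quantity [m' x - m' t]. *)
have dm x : t <= x -> is_cderive (fun x => m x + - m' t * x%:C) x (m' x - m' t).
  move=> tx; have dx : is_cderive (fun x => x%:C : R[i]) x 1.
    by split; [exact: is_derive_id | exact: is_derive_cst].
  have := is_cderiveD (is_cderive_amplitude c (dy x (lt_le_trans t0 tx)))
    (is_cderiveM (is_cderive_cst (- m' t) x) dx).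
  by congr (is_cderive _ _ _); rewrite mul0r add0r mulr1.
have h : normc ((m (t + 1) + - m' t * (t + 1)%:C) - (m t + - m' t * t%:C)) <= e / 2.
  have -> : e / 2 = 2 * (e / 4 * (t + 1) - e / 4 * t) by field.
  apply: (@normc_increment_le _ t (t + 1) (fun x => m x + - m' t * x%:C)
    (fun x => e / 4 * x)) => //.
  - apply: cabs_continuousD; first exact: (cabs_continuous_amplitude c sp (ltW t0)).
    apply: cabs_continuousM => //; first exact: cabs_continuous_cst.
    by split; [exact: abs_continuous_id | exact: abs_continuous_cst].
  - by apply: abs_continuousM => //; [exact: abs_continuous_cst | exact: abs_continuous_id].
  - apply: aeW => x /andP[tx _]; exists (m' x - m' t); first exact/dm/ltW.
    exists (e / 4); last exact/m'm'/ltW.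
    by have := @is_deriveZ _ _ _ id (e / 4) x 1 1 (is_derive_id _ _);
      rewrite /GRing.scale /= mulr1.
have -> : m' t = (m (t + 1) - 1) - (m t - 1) -
    ((m (t + 1) + - m' t * (t + 1)%:C) - (m t + - m' t * t%:C)).
  by rewrite rmorphD rmorph1; ring.
have := me t (lexx _); have := me (t + 1) tt1.
have := normcB (m (t + 1) - 1) (m t - 1).
set u := (X in normc X <= _ -> _); set v := (X in normc X <= e / 2) in h.
by have := normcB u v; lra.
Qed.

(** With [d = - c] the factored equation reads [(m' e^(2 c x))' = q m e^(2 c x)]. The weight has
    modulus [E], nonincreasing because [Re c <= 0], so integrating from [x] out to [z] and dividing
    by [E x] loses nothing; the boundary term at [z] is at most [e]. The bound is thus uniform up to
    the real axis in [k]. *)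
Lemma amplitude'_le c y y' A M :
  complex.Re c <= 0 -> 0 <= A -> schrodinger_pair q (- c ^+ 2) y y' ->
  amplitude_tends_to_1 c y ->
  (forall x, A <= x -> normc (amplitude c y x) <= M) ->
  forall x, A <= x -> normc (amplitude' c y y' x) <= 2 * M * T x.
Proof.
move=> c0 A0 sp lim hM x Ax.
have x0 : 0 <= x by exact: le_trans Ax.
have M0 : 0 <= M by exact: le_trans (normc_ge0 _) (hM A (lexx _)).
apply/ler_addgt0Pr => e e0.
have [X X0 hX] := amplitude'_small sp lim e0.
pose z := Num.max X x.
have xz : x <= z by rewrite le_max lexx orbT.
have {hX} hz : normc (amplitude' c y y' z) <= e by apply: hX; rewrite le_max lexx.
pose E t := expR (2 * complex.Re c * t).
have EM t : normc (cexp (c * t%:C)) = E t * normc (cexp (- c * t%:C)).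
  rewrite !normc_cexp /E. rewrite !Re_mul /= !mulr0 !subr0 Re_opp -expRD; congr expR; ring.
have sp' : schrodinger_pair q (- (- c) ^+ 2) y y' by rewrite sqrrN.
have Edecr t : x <= t -> E t <= E x.
  by move=> xt; rewrite ler_expR ler_wnM2l //; lra.
have h : normc ((y' z + - c * y z) * cexp (- - c * z%:C) -
    (y' x + - c * y x) * cexp (- - c * x%:C)) <= 2 * (E x * M) * (T x - T z).
  apply: factored_increment_le => // t /andP[xt _].
  rewrite normcM opprK EM mulrCA -normcM; apply: ler_pM; rewrite ?normc_ge0 ?expR_ge0 //.
    exact: Edecr.
  exact/hM/(le_trans Ax).
have pE t : normc ((y' t + - c * y t) * cexp (- - c * t%:C)) =
    E t * normc (amplitude' c y y' t).
  by rewrite /amplitude' normcM opprK EM mulNr mulrCA -normcM.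
have hx : E x * normc (amplitude' c y y' x) <=
    E z * normc (amplitude' c y y' z) + 2 * (E x * M) * (T x - T z).
  rewrite -!pE -lerBlDl; apply: le_trans h.
  set p := (X in normc X - _); set p' := (X in _ - normc X).
  have := normcB p' (p' - p); rewrite opprB addrCA subrr addr0 (normc_distrC p' p).
  by rewrite normc_distrC; lra.
have Ex0 : 0 < E x by exact: expR_gt0.
have hE : E z * normc (amplitude' c y y' z) <= E x * e.
  by apply: ler_pM; rewrite ?normc_ge0 ?expR_ge0 // Edecr.
have [_ _ TU0 _ _] := tail; have [Tz _] := TU0 z.
have hT : (E x * M) * T z >= 0 by rewrite !mulr_ge0 // ltW.
rewrite -(ler_pM2l Ex0).
have -> : E x * (2 * M * T x + e) = 2 * (E x * M) * T x + E x * e by ring.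
lra.
Qed.

(** The bound on [m'] is integrated from [x] out to a point where [m] is within [e] of 1. [M] is
    left free for two uses: with the supremum of [|m|], then with its value 2. *)
Lemma amplitude_sub1_le c y y' A M :
  complex.Re c <= 0 -> 0 <= A -> schrodinger_pair q (- c ^+ 2) y y' ->
  amplitude_tends_to_1 c y ->
  (forall x, A <= x -> normc (amplitude c y x) <= M) ->
  forall x, A <= x -> normc (amplitude c y x - 1) <= 4 * M * U x.
Proof.
move=> c0 A0 sp lim hM x Ax; have [dy _ _] := sp.
have x0 : 0 <= x by exact: le_trans Ax.
have M0 : 0 <= M by exact: le_trans (normc_ge0 _) (hM A (lexx _)).
have hm' := amplitude'_le c0 A0 sp lim hM.
have [acTU dTU TU0 xTU _] := tail.
apply/ler_addgt0Pr => e e0; have [X hX] := lim _ e0.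
pose z := Num.max X x.
have xz : x <= z by rewrite le_max lexx orbT.
have hz : normc (amplitude c y z - 1) <= e by apply: hX; rewrite le_max lexx.
have [acT acU] := acTU x z.
(* [U - x T] is a primitive of [- T] *)
have h : normc (amplitude c y z - amplitude c y x) <=
    2 * (- (2 * M) * (U z - z * T z) - - (2 * M) * (U x - x * T x)).
  apply: (@normc_increment_le _ x z _ (fun t => - (2 * M) * (U t - t * T t)) xz).
  - exact: cabs_continuous_amplitude sp x0 xz.
  - apply: abs_continuousM => //; first exact: abs_continuous_cst.
    apply: abs_continuousB => //; apply: abs_continuousM => //.
    exact: abs_continuous_id.
  - apply: ae_imply dTU => t ht /andP[xt tz].
    have t0 : 0 < t by exact: le_lt_trans xt.
    have [dT dU] := ht t0.
    exists (amplitude' c y y' t); first exact: is_cderive_amplitude (dy t t0).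
    exists (2 * M * T t); last by apply: hm'; rewrite (le_trans Ax) // ltW.
    have D := @is_deriveZ _ _ _ _ (- (2 * M)) t 1 _
      (is_deriveB dU (is_deriveM (is_derive_id t 1) dT)).
    have := D; congr (is_derive _ _ _ _); rewrite /GRing.scale /=; ring.
have zT := xTU z (le_trans x0 xz); have [Tx Ux] := TU0 x.
have xT0 : 0 <= M * (x * T x) by rewrite !mulr_ge0.
have Uz0 : 0 <= M * (U z - z * T z) by rewrite mulr_ge0 // subr_ge0.
have := normcB (amplitude c y z - 1) (amplitude c y z - amplitude c y x).
by rewrite opprB addrC addrA subrK => /le_trans; apply; lra.
Qed.

(** A bootstrap: if [M] is the supremum of [|m|] past [A], then [|m - 1| <= 4 M U <= M / 2] by the
    choice of [1 / 8], so [M <= 1 + M / 2] and [M <= 2]. Absorbing [M / 2] requires [M] to be finite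
    beforehand, which the limit gives near infinity and absolute continuity on the remaining compact
    interval. *)
Lemma amplitude_bounds c y y' A :
  complex.Re c <= 0 -> 0 <= A -> schrodinger_pair q (- c ^+ 2) y y' ->
  amplitude_tends_to_1 c y ->
  (forall x, A <= x -> U x <= 1 / 8) ->
  forall x, A <= x -> [/\ normc (amplitude c y x) <= 2,
    normc (amplitude c y x - 1) <= 8 * U x & normc (amplitude' c y y' x) <= 4 * T x].
Proof.
move=> c0 A0 sp lim UA; set m := amplitude c y.
have mle x : normc (m x) <= 1 + normc (m x - 1).
  by rewrite -{1}(subrK 1 (m x)) addrC (le_trans (le_normcD _ _)) // normc1.
pose S : set R := [set normc (m x) | x in [set x | A <= x]].
have hS : has_sup S.
  split; first by exists (normc (m A)); exists A => //=; exact: lexx.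
  have [X hX] := lim _ ltr01; pose B := Num.max 0 X.
  have B0 : 0 <= B by rewrite le_max lexx.
  have [ac1 ac2] := cabs_continuous_amplitude c sp (lexx 0) B0.
  have [M1 M10 hM1] := abs_continuous_bounded B0 ac1.
  have [M2 M20 hM2] := abs_continuous_bounded B0 ac2.
  exists (M1 + M2 + 2) => _ [x /= Ax <-]; have [xB|Bx] := leP x B.
    have xB' : 0 <= x <= B by rewrite (le_trans A0 Ax).
    have := normc_le_ReIm (m x); have := hM1 x xB'; have := hM2 x xB'.
    by rewrite -/m; lra.
  have := hX x; rewrite -/m => /(_ _)-h.
  have := mle x; have := h (le_trans (_ : X <= B) (ltW Bx)).
  by rewrite le_max lexx orbT => /(_ isT); lra.
set M := sup S.
have hM x : A <= x -> normc (m x) <= M.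
  by move=> Ax; apply: ub_le_sup; [case: hS | exists x].
have M0 : 0 <= M by exact: le_trans (normc_ge0 _) (hM A (lexx _)).
have sub1 := amplitude_sub1_le c0 A0 sp lim hM.
have M2 : M <= 2.
  have : M <= 1 + M / 2.
    apply: ge_sup => [|_ [x /= Ax <-]]; first by case: hS.
    apply: (le_trans (mle x)); rewrite lerD2l; apply: (le_trans (sub1 x Ax)).
    have : M * U x <= M * (1 / 8) by rewrite ler_wpM2l // UA.
    lra.
  lra.
have hM2 x : A <= x -> normc (m x) <= 2 by move=> /hM /le_trans; apply.
move=> x Ax; split; first exact: hM2.
- by have := amplitude_sub1_le c0 A0 sp lim hM2 Ax; rewrite -/m; lra.
- by have := amplitude'_le c0 A0 sp lim hM2 Ax; lra.
Qed.

End amplitude.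

(** * The Wronskian *)

Lemma jost_solution_amplitude (R : realType) (q : R -> R) (k : R[i]) (y : R -> R[i]) :
  jost_solution q k y -> exists y', schrodinger_pair q (- ('i%C * k) ^+ 2) y y' /\
    amplitude_tends_to_1 ('i%C * k) y.
Proof.
move=> [/schrodinger_solution_pair[y' sp] lim]; exists y'; split.
  by rewrite exprMn sqr_i mulN1r opprK.
move=> e e0; have eC : 0 < e%:C :> R[i] by rewrite ltcR.
have [X [_ hX]] : \forall x \near +oo%R,
    `|1 - y x / cexp ('i%C * k * x%:C)| < e%:C :> R[i].
  by move/cvgrPdist_lt : lim => /(_ _ eC).
exists (X + 1) => x Xx; have Xx' : X < x by lra.
have := hX x Xx'; rewrite normc_normr ltcR normc_distrC => /ltW.
congr (normc (_ - _) <= _); rewrite /amplitude.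
have cK := cexpNK ('i%C * k * x%:C).
rewrite mulNr; apply: (mulIf (_ : cexp ('i%C * k * x%:C) != 0)).
  by apply/eqP => c0; move: cK; rewrite c0 mul0r => /esym/eqP; rewrite oner_eq0.
rewrite -[RHS]mulrA (mulrC (cexp (- _))) cK mulr1 divfK //.
by apply/eqP => c0; move: cK; rewrite c0 mul0r => /esym/eqP; rewrite oner_eq0.
Qed.

Section estimates.
Variables (R : realType) (q T U : R -> R).
Hypothesis tail : tail_pair q T U.
Implicit Types (c d : R[i]) (y : R -> R[i]) (a b x : R).

Lemma amplitudeK c y x : y x = amplitude c y x * cexp (c * x%:C).
Proof. by rewrite /amplitude -mulrA mulNr (mulrC (cexp _)) cexpNK mulr1. Qed.

Lemma amplitude'K c y y' x :
  y' x = (amplitude' c y y' x + c * amplitude c y x) * cexp (c * x%:C).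
Proof.
rewrite /amplitude' /amplitude mulrA -mulrDl subrK -mulrA mulNr (mulrC (cexp _)).
by rewrite cexpNK mulr1.
Qed.

Lemma normc_cexp_le1 c x : complex.Re c <= 0 -> 0 <= x -> normc (cexp (c * x%:C)) <= 1.
Proof.
move=> c0 x0; rewrite normc_cexp Re_mul /= mulr0 subr0 -expR0 ler_expR.
by rewrite mulr_le0_ge0.
Qed.

(** Past [A] the amplitude bounds give [|y| <= 2]. They also bound [y] and [y'] at [A], and Gronwall
    run backwards from [A] covers [[0, A]]; as [A] and the energy bound [B] do not involve [c],
    neither does [C]. *)
Lemma jost_uniform_bound : exists2 C : R, 0 <= C & forall c y y',
  complex.Re c <= 0 -> normc c <= 1 -> schrodinger_pair q (- c ^+ 2) y y' ->
  amplitude_tends_to_1 c y -> forall x, 0 <= x -> normc (y x) <= C.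
Proof.
have [acTU _ TU0 _ limU] := tail.
have [|A A0 hA] := limU (1 / 8); first by rewrite divr_gt0.
have [M M0 hM] := abs_continuous_bounded A0 (acTU 0 A).1.
pose B := (2 ^+ 2 + (4 * T A + 2) ^+ 2) * expR (2 * A + M).
have B0 : 0 <= B by rewrite mulr_ge0 ?expR_ge0 // addr_ge0 // sqr_ge0.
exists (2 + (1 + B)) => [|c y y' c0 c1 sp lim x x0]; first by rewrite !addr_ge0.
have bnd := amplitude_bounds tail c0 A0 sp lim hA.
have yle t : A <= t -> normc (y t) <= 2.
  move=> At; rewrite (amplitudeK c) normcM.
  have [h _ _] := bnd t At; have := normc_cexp_le1 c0 (le_trans A0 At).
  by move=> h1; rewrite -[leRHS]mulr1 ler_pM ?normc_ge0.
have [Ax|xA] := leP A x; first by have := yle x Ax; lra.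
have y'A : normc (y' A) <= 4 * T A + 2.
  rewrite (amplitude'K c y) normcM -[leRHS]mulr1.
  have [h1 _ h3] := bnd A (lexx _).
  apply: ler_pM; rewrite ?normc_ge0 ?normc_cexp_le1 //.
  apply: (le_trans (le_normcD _ _)); rewrite lerD // normcM.
  by rewrite -[leRHS]mul1r ler_pM ?normc_ge0.
have c2 : normc (- c ^+ 2) <= 1 by rewrite normcN normcX exprn_ile1 ?normc_ge0.
have [_ E2] := energy_gronwall tail sp c2 x0 (ltW xA).
have yxB : normc (y x) ^+ 2 <= B.
  apply: le_trans (_ : normc (y x) ^+ 2 + normc (y' x) ^+ 2 <= _).
    by rewrite lerDl sqr_ge0.
  apply: (le_trans E2); apply: ler_pM; rewrite ?expR_ge0 ?addr_ge0 ?sqr_ge0 //.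
    have TA := (TU0 A).1.
    by apply: lerD; rewrite lerXn2r ?nnegrE ?normc_ge0 ?yle //; lra.
  rewrite ler_expR; have := hM x; rewrite x0 ltW // => /(_ isT).
  by have := ler_norm (T x); have := (TU0 A).1; lra.
(* Since [B <= (1 + B)^2], no square root of [B] is needed. *)
have : normc (y x) <= 1 + B.
  rewrite -(@ler_pXn2r _ 2) ?nnegrE ?normc_ge0 ?addr_ge0 //.
  have : 0 <= B ^+ 2 by exact: sqr_ge0.
  by rewrite sqrrD expr1n mul1r mulr2n; lra.
lra.
Qed.

Lemma jost_derivative0_neq0 y y' :
  schrodinger_pair q (- (0 : R[i]) ^+ 2) y y' -> amplitude_tends_to_1 0 y ->
  y 0 = 0 -> y' 0 != 0.
Proof.
move=> sp lim y0; apply/eqP => y'0.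
have z1 : normc (- (0 : R[i]) ^+ 2) <= 1 by rewrite normcN normcX normc0 expr0n.
have [|X hX] := lim (1 / 2); first by rewrite divr_gt0.
pose x := Num.max 0 X; have x0 : 0 <= x by rewrite le_max lexx.
have [] := energy_gronwall tail sp z1 (lexx 0) x0.
rewrite y0 y'0 normc0 expr0n addr0 mul0r => h _.
have yx : y x = 0.
  apply: eq0_normc; apply/eqP; rewrite -sqrf_eq0 eq_le sqr_ge0 andbT.
  by apply: le_trans h; rewrite lerDl sqr_ge0.
have := hX x; rewrite le_max lexx orbT => /(_ isT).
by rewrite /amplitude yx mul0r sub0r normcN normc1; lra.
Qed.

(* Evaluates the Wronskian of [y] and [f] at [X = e / |c|], a point that tends
   to infinity while the phase [c X] and the integral of [c^2 y f] over [0, X]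
   relative to [c] both stay of order [e]. *)
Lemma jost_wronskian_estimate f f' :
  schrodinger_pair q (- (0 : R[i]) ^+ 2) f f' -> amplitude_tends_to_1 0 f ->
  f 0 = 0 ->
  exists2 K : R, 0 < K & forall e : R, 0 < e -> e <= 1 ->
    exists2 r : R, 0 < r & forall c y y', 0 < normc c -> normc c < r ->
      complex.Re c <= 0 -> schrodinger_pair q (- c ^+ 2) y y' ->
      amplitude_tends_to_1 c y -> normc (y 0 * f' 0 + c) <= K * e * normc c.
Proof.
move=> spf limf f0; have [acTU _ TU0 xTU limU] := tail.
have [C C0 hC] := jost_uniform_bound.
(* The summand [2 * C ^+ 2] comes from the increment of the Wronskian over [[0, X]], and 42 is
   [16 + 26] from the bounds [B1] and [B2] at [X]. *)
exists (2 * C ^+ 2 + 42) => [|e e0 e1]; first by rewrite ltr_wpDl ?mulr_ge0 ?sqr_ge0.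
(* The value [1 / 8] is what the amplitude bounds require; [e ^+ 2] serves to make
   [T X <= U X / X <= e * n]. *)
have u0 : 0 < Num.min (1 / 8) (e ^+ 2) by rewrite lt_min exprn_gt0 // divr_gt0.
have [A A0 hA] := limU _ u0.
have hA8 x : A <= x -> U x <= 1 / 8.
  by move=> /hA /le_trans; apply; rewrite ge_min lexx.
have hAe x : A <= x -> U x <= e ^+ 2.
  by move=> /hA /le_trans; apply; rewrite ge_min lexx orbT.
(* This radius gives both [|c| <= 1], for the uniform bound, and [A <= X]. *)
exists (Num.min 1 (e / (A + 1))) => [|c y y' n0].
  by rewrite lt_min ltr01 divr_gt0 //; lra.
rewrite lt_min => /andP[n1 nA] c0 sp lim.
set n := normc c in n0 n1 nA *.
pose X := e / n; have nX : n * X = e by rewrite mulrC divfK // gt_eqF.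
have X0 : 0 < X by exact: divr_gt0.
have AX : A <= X.
  rewrite /X ler_pdivlMr //; move: nA; rewrite ltr_pdivlMr; last by lra.
  by rewrite mulrC; nra.
have [my my1 my'] := amplitude_bounds tail c0 A0 sp lim hA8 AX.
have Re0 : complex.Re (0 : R[i]) <= 0 by [].
have [mf mf1 mf'] := amplitude_bounds tail Re0 A0 spf limf hA8 AX.
have n01 : normc (0 : R[i]) <= 1 by rewrite normc0.
have yC := hC c y y' c0 (ltW n1) sp lim.
have fC := hC 0 f f' Re0 n01 spf limf.
have [dy acy dy'] := sp; have [df acf df'] := spf.
have dlin (L x : R) : is_derive x 1 (fun t => L * t) L.
  have := @is_deriveZ _ _ _ id L x 1 1 (is_derive_id _ _).
  by rewrite /GRing.scale /= mulr1.
have aclin (L : R) : abs_continuous 0 X (fun t => L * t).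
  apply: abs_continuousM; [exact: ltW | exact: abs_continuous_cst |].
  exact: abs_continuous_id.
have W : normc ((y X * f' X + -1 * (y' X * f X)) - (y 0 * f' 0 + -1 * (y' 0 * f 0))) <=
    2 * (n ^+ 2 * C ^+ 2 * X - n ^+ 2 * C ^+ 2 * 0).
  apply: (@normc_increment_le _ 0 X (fun x => y x * f' x + -1 * (y' x * f x))
    (fun x => n ^+ 2 * C ^+ 2 * x) (ltW X0)) => //.
    have [cy cy'] := acy 0 X (lexx _); have [cf cf'] := acf 0 X (lexx _).
    have X0' := ltW X0.
    apply: cabs_continuousD; first exact: cabs_continuousM.
    apply: cabs_continuousM => //; first exact: cabs_continuous_cst.
    exact: cabs_continuousM.
  apply: ae_imply2 dy' df' => x h1 h2 /andP[x0 xX].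
  exists (- c ^+ 2 * (y x * f x)).
    have := is_cderiveD (is_cderiveM (dy x x0) (h2 x0))
      (is_cderiveM (is_cderive_cst (-1) x) (is_cderiveM (h1 x0) (df x x0))).
    by congr (is_cderive _ _ _); ring.
  exists (n ^+ 2 * C ^+ 2) => //; rewrite !normcM normcN normcX expr2 (expr2 C).
  rewrite -expr2 ler_wpM2l ?sqr_ge0 //.
  by apply: ler_pM; rewrite ?normc_ge0 ?yC ?fC // ltW.
have eX : normc (cexp (c * X%:C) - 1) <= 2 * e.
  suff : normc (cexp (c * X%:C) - cexp (c * 0%:C)) <= 2 * (n * X - n * 0).
    by rewrite !mulr0 cexp0 subr0 nX.
  apply: (@normc_increment_le _ 0 X (fun x => cexp (c * x%:C)) (fun x => n * x) (ltW X0)) => //.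
    exact/cabs_continuous_cexp/ltW.
  apply: aeW => x /andP[x0 _]; exists (c * cexp (c * x%:C)); first exact: is_cderive_cexp.
  exists n => //; rewrite normcM -[leRHS]mulr1 ler_wpM2l ?normc_ge0 //.
  exact/normc_cexp_le1/ltW.
set m := amplitude c y in my my1; set m' := amplitude' c y y' in my'.
have fE : amplitude 0 f X = f X by rewrite /amplitude oppr0 mul0r cexp0 mulr1.
have f'E : amplitude' 0 f f' X = f' X.
  by rewrite /amplitude' oppr0 !mul0r cexp0 subr0 mulr1.
rewrite fE in mf mf1; rewrite f'E in mf'.
set E := cexp (c * X%:C) in eX.
have E1 : normc E <= 1 by exact/normc_cexp_le1/ltW.
have yXE : y X = m X * E by exact: amplitudeK.
have y'XE : y' X = (m' X + c * m X) * E by exact: amplitude'K.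
clearbody E m m'; have UX := hAe X AX; have [TX0 UX0] := TU0 X.
have TX : T X <= e * n.
  have := xTU X (ltW X0) => h; rewrite -(ler_pM2l X0).
  have -> : X * (e * n) = e ^+ 2 by rewrite mulrCA (mulrC X) nX.
  exact: le_trans h UX.
have e2 : e ^+ 2 <= e by rewrite expr2 ler_piMl // ltW.
(* As [f 0 = 0], the left side is [W(X) + c] minus the increment of the Wronskian [W]. At [X], the
   part [m f' - m' f] is split from [- c m f E], and [m f E - 1] is telescoped into three
   differences from 1. *)
have -> : y 0 * f' 0 + c = - ((y X * f' X + -1 * (y' X * f X)) - (y 0 * f' 0 + -1 * (y' 0 * f 0))) +
    ((m X * f' X - m' X * f X) * E - c * ((m X - 1) * (E * f X) + ((f X - 1) * E + (E - 1)))).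
  by rewrite f0 yXE y'XE; ring.
have B1 : normc ((m X * f' X - m' X * f X) * E) <= 16 * (e * n).
  rewrite normcM -[leRHS]mulr1; apply: ler_pM; rewrite ?normc_ge0 //.
  apply: (le_trans (normcB _ _)); rewrite !normcM.
  have h1 : normc (m X) * normc (f' X) <= 2 * (4 * T X) by apply: ler_pM; rewrite ?normc_ge0.
  have h2 : normc (m' X) * normc (f X) <= 4 * T X * 2 by apply: ler_pM; rewrite ?normc_ge0.
  lra.
have B2 : normc ((m X - 1) * (E * f X) + ((f X - 1) * E + (E - 1))) <= 26 * e.
  have h1 : normc (m X - 1) * (normc E * normc (f X)) <= 8 * U X * (1 * 2).
    by apply: ler_pM; rewrite ?mulr_ge0 ?normc_ge0 // ler_pM ?normc_ge0.
  have h2 : normc (f X - 1) * normc E <= 8 * U X * 1 by apply: ler_pM; rewrite ?normc_ge0.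
  apply: (le_trans (le_normcD _ _)).
  have h3 := le_normcD ((f X - 1) * E) (E - 1); rewrite !normcM in h3 *.
  lra.
apply: (le_trans (le_normcD _ _)); rewrite normcN.
have B3 := normcB ((m X * f' X - m' X * f X) * E)
  (c * ((m X - 1) * (E * f X) + ((f X - 1) * E + (E - 1)))).
have B4 : normc (c * ((m X - 1) * (E * f X) + ((f X - 1) * E + (E - 1)))) <= n * (26 * e).
  by rewrite normcM ler_wpM2l ?normc_ge0.
have WE : 2 * (n ^+ 2 * C ^+ 2 * X - n ^+ 2 * C ^+ 2 * 0) = 2 * C ^+ 2 * (e * n).
  by rewrite -nX; ring.
rewrite WE in W.
have -> : (2 * C ^+ 2 + 42) * e * n = 2 * C ^+ 2 * (e * n) + (16 * (e * n) + n * (26 * e)).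
  by ring.
apply: lerD => //; apply: (le_trans B3); exact: lerD.
Qed.

End estimates.

Theorem theorem3p1p3 (R : realType) (q : R -> R) (F : R[i] -> R[i])
    (hq : L11 q) (hF : jost_function q F) (hF0 : F 0 = 0) :
  exists2 d : R[i], is_derivative_uhp F 0 d & d != 0.
Proof.
have [T [U tail]] := tail_pair_exists hq.
have [|f jf Ff] := hF 0; first by [].
have f0 : f 0 = 0 by rewrite -Ff.
have [f'] := jost_solution_amplitude jf; rewrite mulr0 => -[spf limf].
have w0 : f' 0 != 0 := jost_derivative0_neq0 tail spf limf f0.
have [K K0 est] := jost_wronskian_estimate tail spf limf f0.
have i0 : ('i%C : R[i]) != 0 by rewrite eq_complex /= oner_eq0 andbF.
exists (- 'i%C / f' 0); last by rewrite mulf_neq0 ?invr_eq0 // oppr_eq0.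
have N0 : 0 < normc (f' 0).
  by rewrite lt_neqAle normc_ge0 andbT eq_sym; apply: contra w0 => /eqP/eq0_normc/eqP.
apply/cvgrPdist_le => e' e'0.
(* In the order on [R[i]], a positive element is real. *)
have [e e0 ->] : exists2 e : R, 0 < e & e' = e%:C.
  by case: e' e'0 => a b; rewrite ltcE /= => /andP[/eqP-> a0]; exists a.
(* Dividing the Wronskian estimate by [f' 0 * k] leaves the error [K * s / |f' 0|], which this
   choice keeps below [e]. *)
pose s := Num.min 1 (e * normc (f' 0) / K).
have s0 : 0 < s by rewrite lt_min ltr01 divr_gt0 // mulr_gt0.
have s1 : s <= 1 by rewrite ge_min lexx.
have [r r0 hr] := est s s0 s1.
have rC : 0 < r%:C :> R[i] by rewrite ltcR.
have key (k : R[i]) : 0 <= complex.Im k -> k != 0 -> normc k < r ->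
    normc (- 'i%C / f' 0 - (F k - F 0) / (k - 0)) <= e.
  move=> k0 kn0 kr; have [y jy Fk] := hF k k0.
  have [y' [sp lim]] := jost_solution_amplitude jy.
  have nk : normc ('i%C * k) = normc k by rewrite normcM normci mul1r.
  have nk0 : 0 < normc k.
    by rewrite lt_neqAle normc_ge0 andbT eq_sym; apply: contra kn0 => /eqP/eq0_normc/eqP.
  have Reik : complex.Re ('i%C * k) <= 0 by rewrite Re_mul /= mul0r mul1r sub0r oppr_le0.
  have := hr ('i%C * k) y y'; rewrite nk => /(_ nk0 kr Reik sp lim) h.
  have -> : - 'i%C / f' 0 - (F k - F 0) / (k - 0) = - (y 0 * f' 0 + 'i%C * k) / (f' 0 * k).
    by rewrite hF0 !subr0 Fk; field; rewrite w0 kn0.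
  rewrite normcM normcV normcN normcM ler_pdivrMr ?mulr_gt0 // mulrA.
  apply: (le_trans h); rewrite ler_pM2r //.
  have : s <= e * normc (f' 0) / K by rewrite ge_min lexx orbT.
  by rewrite ler_pdivlMr // mulrC.
apply/(@nbhs_ballP _ R[i]^o); exists r%:C => //= k.
rewrite /ball /= sub0r normrN normc_normr ltcR => kr kn0 k0.
by rewrite normc_normr lecR; exact: key.
Qed.
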